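(* Let $n \ge m \ge 1$ be integers. For $p>0$ and $\alpha \ge 0$, define, for $M \in \mathbb{R}^{n\times m}$ with singular values $\sigma_1\ge\cdots\ge\sigma_m\ge 0$, $$\pi_{p,\alpha}(M) = \|M\|_p^{-\alpha} = \left(\sum_{i=1}^m \sigma_i^p\right)^{-\alpha/p}.$$ Then: (i) for $p\in[1,2]$, $\pi_{p,\alpha}$ is superharmonic on $\mathbb{R}^{n\times m}$ if $\alpha\in[0,\ nm-(1-p/2)m(m+1)-p]$; (ii) for $p\in(0,1)$, $\pi_{p,\alpha}$ is superharmonic on $\mathbb{R}^{n\times m}$ if $\alpha\in[0,\ nm-m(m+1)+(m-1)p]$.
   Context: $\|M\|_p = (\sum_{i=1}^m\sigma_i^p)^{1/p}$ where $\sigma_1\ge\cdots\ge\sigma_m$ are the singular values of $M$. The space $\mathbb{R}^{n\times m}$ is identified with $\mathbb{R}^{nm}$. A function $\pi:\mathbb{R}^{n\times m}\to(-\infty,+\infty]$ is superharmonic if it is lower semicontinuous, not identically $+\infty$, and its value at each point is at least its average over every sphere centered at that point; for a $C^2$ function this is equivalent to $\Delta\pi(M)=\sum_{i=1}^n\sum_{j=1}^m \frac{\partial^2\pi}{\partial M_{ij}^2}(M)\le 0$ for every $M$. For $\alpha>0$ one sets $\pi_{p,\alpha}(0)=+\infty$, and $\pi_{p,0}\equiv 1$. *)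

(* Defs.v *)
From HB Require Import structures.
From mathcomp Require Import all_boot all_order all_algebra.
From mathcomp Require Import complex.
From mathcomp Require Import all_classical all_reals all_analysis.

Set Implicit Arguments.
Unset Strict Implicit.
Unset Printing Implicit Defensive.

Import Order.TTheory GRing.Theory Num.Theory.
Import numFieldNormedType.Exports.

Local Open Scope classical_set_scope.
Local Open Scope ring_scope.

(* The square roots of the eigenvalues of M^T M, repeated according to their
   multiplicity as roots of the characteristic polynomial, in nonincreasing
   order. *)
Definition is_singular_values (R : realType) (n m : nat) (M : 'M[R]_(n, m))
    (s : m.-tuple R) : Prop :=
  [/\ sorted >=%R s, all (fun x => 0 <= x) s &
      char_poly (M^T *m M) = \prod_(x <- s) ('X - (x ^+ 2)%:P)].

Lemma char_poly_conjugate (F : fieldType) (m : nat) (P A : 'M[F]_m) :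
  P \in unitmx -> char_poly (invmx P *m A *m P) = char_poly A.
Proof.
move=> Pu; rewrite /char_poly.
have -> : char_poly_mx (invmx P *m A *m P) =
    map_mx polyC (invmx P) *m char_poly_mx A *m map_mx polyC P.
  rewrite /char_poly_mx mulmxBr mulmxBl !map_mxM; congr (_ - _).
  by rewrite scalar_mxC -mulmxA -map_mxM mulVmx// map_mx1 mulmx1.
by rewrite !det_mulmx mulrAC -det_mulmx -map_mxM mulVmx// map_mx1 det1 mul1r.
Qed.

Lemma singular_values_exist (R : realType) (n m : nat) (M : 'M[R]_(n, m)) :
  exists s : m.-tuple R, is_singular_values M s.
Proof.
pose toC : {rmorphism R -> R[i]} := real_complex R.
pose MC := map_mx toC M.
have MCt : map_mx Num.conj (trmx MC) = trmx MC.
  by apply/matrixP => i j; rewrite !mxE -[RHS]conjc_real.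
have conj2 k l (X : 'M[R[i]]_(k, l)) : map_mx Num.conj (map_mx Num.conj X) = X.
  by apply/matrixP => i j; rewrite !mxE conjCK.
pose A := map_mx Num.conj (trmx MC) *m MC.
have Ah : A \is hermsymmx.
  apply/is_hermitianmxP; rewrite expr0 scale1r /A trmx_mul map_mxM.
  by rewrite -map_trmx trmxK conj2.
have /orthomx_spectralP := hermitian_normalmx Ah.
set P := spectralmx A; set D := spectral_diag A => AE.
have Pu : P \is unitarymx := spectral_unitarymx A.
have Du : diag_mx D = map_mx Num.conj (trmx (MC *m map_mx Num.conj (trmx P)))
                      *m (MC *m map_mx Num.conj (trmx P)).
  rewrite trmx_mul map_mxM -map_trmx trmxK conj2.
  transitivity (P *m A *m invmx P); last first.
    by rewrite invmx_unitary // /A map_trmx !mulmxA.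
  by rewrite [X in P *m X]AE !mulmxA mulmxV ?spectral_unit // mul1mx mulmxK
    ?spectral_unit.
have D0 i : 0 <= D 0 i.
  have /matrixP /(_ i i) := Du; rewrite mxE eqxx mulr1n => ->.
  set Y := MC *m _; rewrite mxE sumr_ge0 // => k _.
  by rewrite [X in X * _]mxE [X in X^* * _]mxE mulrC mul_conjC_ge0.
pose s := sort >=%R [seq Num.sqrt (complex.Re (D 0 i)) | i <- enum 'I_m].
have ss : size s == m by rewrite size_sort size_map size_enum_ord.
exists (Tuple ss); split => /=.
- by apply: sort_sorted => x y; apply: le_total.
- by rewrite all_sort; apply/allP => x /mapP[i _ ->]; exact: sqrtr_ge0.
apply: (@map_poly_inj _ _ toC).
rewrite map_char_poly map_mxM -map_trmx -/MC -[X in X *m _]MCt -/A AE.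
rewrite char_poly_conjugate ?spectral_unit // char_poly_trig ?diag_mx_is_trig //.
rewrite rmorph_prod (perm_big _ (permEl (perm_sort _ _))) big_map big_enum /=.
apply: eq_bigr => i _; rewrite mxE eqxx mulr1n map_polyXsubC; congr (_ - _%:P).
have := D0 i; rewrite lecE /= => /andP[/eqP Im0 Re0].
by rewrite sqr_sqrtr //; case: (D 0 i) Im0 => a b /= ->.
Qed.

Lemma singular_values_unique (R : realType) (n m : nat) (M : 'M[R]_(n, m))
    (s t : m.-tuple R) :
  is_singular_values M s -> is_singular_values M t -> s = t.
Proof.
move=> [ss s0 sE] [st t0]; rewrite {}sE.
rewrite -[LHS](big_map (fun x => x ^+ 2) xpredT (fun x => 'X - x%:P)).
rewrite -[RHS](big_map (fun x => x ^+ 2) xpredT (fun x => 'X - x%:P)).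
move=> /prod_XsubC_eq /(perm_map Num.sqrt); rewrite -!map_comp.
have sqrtK (u : seq R) : all (fun x => 0 <= x) u ->
    map (Num.sqrt \o (fun x => x ^+ 2)) u = u.
  by move=> /allP u0; rewrite -[RHS]map_id; apply/eq_in_map => x /u0 x0 /=;
    rewrite sqrtr_sqr ger0_norm.
rewrite !sqrtK // => st_perm; apply/val_inj.
apply: (sorted_eq (leT := >=%R)) => //.
- by move=> x y z /= yx xz; exact: le_trans xz yx.
- by move=> x y /= /andP[yx xy]; apply/le_anti/andP.
Qed.

Definition singular_values (R : realType) (n m : nat) (M : 'M[R]_(n, m)) :
    m.-tuple R :=
  xget [tuple of nseq m 0] [set s | is_singular_values M s].

Lemma singular_valuesP (R : realType) (n m : nat) (M : 'M[R]_(n, m)) :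
  is_singular_values M (singular_values M).
Proof.
have [s sP] := singular_values_exist M.
by apply: xgetPex; exists s.
Qed.

Definition schatten (R : realType) (n m : nat) (p : R) (M : 'M[R]_(n, m)) : R :=
  (\sum_(i < m) tnth (singular_values M) i `^ p) `^ p^-1.

(* The case distinctions are needed because 0 `^ (- a) = 0 for a != 0. *)
Definition schatten_prior (R : realType) (n m : nat) (p a : R)
    (M : 'M[R]_(n, m)) : \bar R :=
  if a == 0 then 1%E
  else if M == 0 then +oo%E
  else ((schatten p M) `^ (- a))%:E.

Definition frobenius (R : realType) (n m : nat) (M : 'M[R]_(n, m)) : R :=
  Num.sqrt (\sum_i \sum_j M i j ^+ 2).

Definition borel_matrix (R : realType) (n m : nat) :=
  g_sigma_algebraType (@open 'M[R]_(n, m)).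

(* Normalized surface measure of the unit sphere of R^(nm), in its usual
   characterization: the Borel probability measure that exists and is unique
   subject to being carried by that sphere and invariant under the orthogonal
   group O(nm), i.e. under all linear isometries of the Frobenius norm and not
   only under M |-> U *m M *m V. *)
Definition is_unit_sphere_measure (R : realType) (n m : nat)
    (mu : probability (borel_matrix R n m) R) : Prop :=
  mu [set V : 'M[R]_(n, m) | frobenius V = 1] = 1%E /\
  forall L : {linear 'M[R]_(n, m) -> 'M[R]_(n, m)},
    (forall V, frobenius (L V) = frobenius V) ->
    forall A : set (borel_matrix R n m), measurable A ->
      mu (L @^-1` A) = mu A.

(* V |-> M + r *: V maps the unit sphere onto the sphere of center M and radius
   r, so the integral is the average of f over the latter. It is well defined in
   ]-oo, +oo], f being lower semicontinuous and > -oo, hence Borel and bounded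
   below on compact sets. *)
Definition superharmonic (R : realType) (n m : nat)
    (f : 'M[R]_(n, m) -> \bar R) : Prop :=
  [/\ forall M, f M != -oo%E,
      lower_semicontinuous f,
      exists M, f M != +oo%E &
      forall (mu : probability (borel_matrix R n m) R),
        is_unit_sphere_measure mu ->
        forall (M : 'M[R]_(n, m)) (r : R), 0 < r ->
          (\int[mu]_V f (M + r *: (V : 'M[R]_(n, m)))%R <= f M)%E].

(* Main.v *)
(* For [e > 0] replace the eigenvalues [x] of [X^T X] by [x + e]: the function
   f_e(X) = (sum_i (x_i + e)^q)^(-c), with q = p/2 and c = alpha/p, is smooth and
   increases to the prior as e decreases to 0, so it suffices to treat f_e and to
   pass to the limit by monotone convergence.

   Let g(x) = (x + e)^q. If u_i and w_j are orthonormal eigenbases of X^T X and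
   Y^T Y with eigenvalues x_i and y_j, then
     sum_j g(y_j) - sum_i g(x_i) = sum_ij <u_i, w_j>^2 (g(y_j) - g(x_i)),
   and <u_i, w_j> (y_j - x_i) is an entry of Y^T Y - X^T X in the two bases. A
   scalar Taylor expansion of g thus yields a second-order expansion of the
   spectral sum, with no trouble at multiple eigenvalues. The Laplacian read off
   it is at most 0 by Chebyshev's sum inequality and, for p >= 1, by the concavity
   of t^(p-1).

   The spherical Laplacian is the sum of the squares of the infinitesimal
   rotations in the coordinate planes. By invariance, the rotated copies of f_e
   have the same spherical means, so the mean phi(r) of f_e over the sphere of
   radius r satisfies phi'' + (nm-1)/r phi' <= 0 in the sense of finite
   differences. Comparing with 1/r, which satisfies the same inequality since
   nm >= 3 unless alpha = 0, gives phi(r) <= phi(0). *)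
Require Import Defs.
From HB Require Import structures.
From mathcomp Require Import all_boot all_order all_algebra.
From mathcomp Require Import ring lra.
From mathcomp Require Import all_classical all_reals all_analysis.
From mathcomp Require Import measurable_realfun.

Set Implicit Arguments.
Unset Strict Implicit.
Unset Printing Implicit Defensive.

Import Order.TTheory GRing.Theory Num.Theory.
Import numFieldNormedType.Exports.

Local Open Scope classical_set_scope.
Local Open Scope ring_scope.

(** * Second-order remainders of scalar functions *)

(** Eigenvalues may fail to be differentiable where they collide, so f_e is never differentiated.
    What is carried instead is [superharmonic_jets]: at every point a linear form and a symmetric
    bilinear form of nonpositive trace matching f_e up to a cubic error, with a constant uniform on
    bounded sets. Cubic, because second differences are measured against t^2; uniform, because they
    are averaged over a sphere. The shift e keeps the argument of every power above a positive
    bound, where powers of exponent at most 1 have bounded derivatives.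

    Origin of the bounds on alpha: up to a nonnegative factor the Laplacian of f_e is 2(c+1) A - S
    B, with A from the squared gradient of the spectral sum S and B from its Laplacian. In B, the
    diagonal and the pairs of eigenvalues lower the coefficient n to n - m - 1 + p, and Chebyshev's
    inequality contributes a factor m. For p >= 1 the trapezoid rule extracts a further positive
    amount from each pair, worth (p/2) m(m-1) in total. *)

Section Bregman.
Context {R : realType}.
Implicit Types (f G : R -> R) (x y s L : R).

Lemma mean_value f (df : R -> R) x y : x <= y ->
    (forall z, x <= z <= y -> is_derive z 1 f (df z)) ->
  exists2 c, x <= c <= y & f y - f x = df c * (y - x).
Proof.
move=> xy fdf.
have [z|| c cxy fc] := @MVT_segment _ f df _ _ xy; last first.
- by exists c => //; rewrite in_itv in cxy.
- apply: derivable_within_continuous => z; rewrite in_itv /= => zxy.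
  exact: (@ex_derive _ _ _ _ _ _ _ (fdf z zxy)).
- by rewrite in_itv /= => /andP[xc cy]; apply: fdf; rewrite !ltW.
Qed.

(** Two mean value steps give f 1 = f2 d * c with 0 <= d <= c <= 1. The factor 1/2 of Taylor's
    formula is given up: only the existence of a bound and, with L = 0, the sign matter below. *)
Lemma second_order_ub f (f1 f2 : R -> R) L : 0 <= L -> f 0 = 0 -> f1 0 = 0 ->
    (forall s, 0 <= s <= 1 -> is_derive s 1 f (f1 s)) ->
    (forall s, 0 <= s <= 1 -> is_derive s 1 f1 (f2 s)) ->
    (forall s, 0 <= s <= 1 -> f2 s <= L) ->
  f 1 <= L.
Proof.
move=> L0 f0 f10 df df1 f2L.
have [c /andP[c0 c1]] := mean_value ler01 df.
rewrite f0 !subr0 mulr1 => ->.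
have [|d /andP[d0 dc]] := @mean_value f1 f2 0 c c0.
  by move=> z /andP[z0 zc]; apply: df1; rewrite z0 (le_trans zc).
rewrite f10 !subr0 => ->.
have d1 : d <= 1 by exact: le_trans c1.
have := f2L d; rewrite d0 d1 => /(_ isT) f2dL.
by rewrite (le_trans (ler_wpM2r c0 f2dL))// ler_piMr.
Qed.

Variables G G1 G2 : R -> R.
Hypothesis dG : forall y, 0 < y -> is_derive y 1 G (G1 y).
Hypothesis dG1 : forall y, 0 < y -> is_derive y 1 G1 (G2 y).

(** The second divided difference of G at x, x, y, extended by continuity to the diagonal. In the
    expansion of a spectral sum it is the weight of the squared entry (i, k) of the perturbation. *)
Definition bregman x y :=
  if y == x then G2 x / 2 else (G y - G x - G1 x * (y - x)) / (y - x) ^+ 2.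

Lemma bregmanE x y :
  G y = G x + G1 x * (y - x) + bregman x y * (y - x) ^+ 2.
Proof.
rewrite /bregman; case: eqVneq => [->|yx]; first by rewrite subrr; ring.
have yx0 : y - x != 0 by rewrite subr_eq0.
by field.
Qed.

(** Dividing the Taylor remainder along the segment from x to y by (y - x)^2 gives a function of s
    in [0, 1] whose second derivative is exactly [G2] at the moving point. Bounds on [G2] thus pass
    to [bregman] without integrals, on and off the diagonal alike. *)
Lemma bregman_rep x y : 0 < x -> 0 < y -> exists k k1 : R -> R,
  [/\ k 0 = 0, k1 0 = 0, k 1 = bregman x y,
    forall s, 0 <= s <= 1 -> is_derive s 1 k (k1 s) &
    forall s, 0 <= s <= 1 -> is_derive s 1 k1 (G2 (x + s * (y - x)))].
Proof.
move=> x0 y0; rewrite /bregman; case: eqVneq => [->|yx].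
  exists (fun s => s ^+ 2 * (G2 x / 2)), (fun s => s * G2 x).
  split => [||||s _]; rewrite ?expr0n ?expr1n ?mul0r ?mul1r//.
    move=> s _; apply: is_derive_eq.
    rewrite /GRing.scale /=; lra.
  apply: is_derive_eq.
  rewrite /GRing.scale /= subrr mulr0 addr0; lra.
have yx0 : y - x != 0 by rewrite subr_eq0.
have pos s : 0 <= s <= 1 -> 0 < x + s * (y - x).
  move=> /andP[s0 s1]; nra.
have daff s : is_derive s 1 (fun s => x + s * (y - x)) (y - x).
  apply: is_derive_eq; rewrite /GRing.scale /=; lra.
exists (fun s => (G (x + s * (y - x)) - G x - G1 x * (s * (y - x))) / (y - x) ^+ 2).
exists (fun s => (G1 (x + s * (y - x)) - G1 x) / (y - x)).
split.
- by rewrite !mul0r addr0 mulr0; field.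
- by rewrite mul0r addr0 subrr mul0r.
- by rewrite !mul1r addrCA subrr addr0.
- move=> s s01; have := pos s s01 => ps.
  have := @is_derive1_comp _ G (fun s => x + s * (y - x)) s _ _ (dG ps) (daff s).
  move=> H.
  apply: is_derive_eq.
  rewrite /GRing.scale /=; field; exact: yx0.
- move=> s s01; have := pos s s01 => ps.
  have := @is_derive1_comp _ G1 (fun s => x + s * (y - x)) s _ _ (dG1 ps) (daff s).
  move=> H.
  apply: is_derive_eq.
  rewrite /GRing.scale /=; field; exact: yx0.
Qed.

Lemma bregman_ub L x y : 0 <= L -> 0 < x -> 0 < y ->
    (forall z, Num.min x y <= z -> G2 z <= L) -> bregman x y <= L.
Proof.
move=> L0 x0 y0 G2L; have [k [k1 [k0 k10 <- dk dk1]]] := bregman_rep x0 y0.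
apply: (second_order_ub L0 k0 k10 dk dk1) => s /andP[s0 s1]; apply: G2L.
by rewrite ge_min; case: (leP x y) => xy; apply/orP; [left|right]; nra.
Qed.

Lemma bregman_lb L x y : 0 <= L -> 0 < x -> 0 < y ->
    (forall z, Num.min x y <= z -> - L <= G2 z) -> - L <= bregman x y.
Proof.
move=> L0 x0 y0 G2L; have [k [k1 [k0 k10 <- dk dk1]]] := bregman_rep x0 y0.
rewrite lerNl -[- k 1]/((- k) 1).
apply: (@second_order_ub _ (- k1) (fun s => - G2 (x + s * (y - x)))).
- exact: L0.
- by rewrite -[LHS]/(- k 0) k0 oppr0.
- by rewrite -[LHS]/(- k1 0) k10 oppr0.
- by move=> s /dk ?; exact: is_deriveN.
- by move=> s /dk1 ?; exact: is_deriveN.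
move=> s /andP[s0 s1]; rewrite lerNl; apply: G2L.
by rewrite ge_min; case: (leP x y) => xy; apply/orP; [left|right]; nra.
Qed.

(** The representations for y and y' share the parameter s, so the second derivative of their
    difference is a difference of values of [G2] at points s * (y - y') apart. *)
Lemma bregman_lip_le L x y y' a : 0 < a -> 0 <= L -> a <= x -> a <= y -> a <= y' ->
    (forall z z', a <= z -> a <= z' -> `|G2 z - G2 z'| <= L * `|z - z'|) ->
  bregman x y - bregman x y' <= L * `|y - y'|.
Proof.
move=> a0 L0 ax ay ay' lipG2.
have [k [k1 [k0 k10 <- dk dk1]]] := bregman_rep (lt_le_trans a0 ax) (lt_le_trans a0 ay).
have [l [l1 [l0 l10 <- dl dl1]]] := bregman_rep (lt_le_trans a0 ax) (lt_le_trans a0 ay').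
rewrite -[k 1 - l 1]/((k - l) 1).
apply: (@second_order_ub _ (k1 - l1)
  (fun s => G2 (x + s * (y - x)) - G2 (x + s * (y' - x)))).
- by rewrite mulr_ge0.
- by rewrite -[LHS]/(k 0 - l 0) k0 l0 subrr.
- by rewrite -[LHS]/(k1 0 - l1 0) k10 l10 subrr.
- by move=> s s01; have ? := dk s s01; have ? := dl s s01; exact: is_deriveB.
- by move=> s s01; have ? := dk1 s s01; have ? := dl1 s s01; exact: is_deriveB.
move=> s /andP[s0 s1]; apply: le_trans (ler_norm _) _.
apply: le_trans (lipG2 _ _ _ _) _; [nra|nra|].
rewrite ler_wpM2l// (_ : _ - _ = s * (y - y')); last by ring.
by rewrite normrM ger0_norm// ler_piMl.
Qed.

Lemma bregman_lip L x y y' a : 0 < a -> 0 <= L -> a <= x -> a <= y -> a <= y' ->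
    (forall z z', a <= z -> a <= z' -> `|G2 z - G2 z'| <= L * `|z - z'|) ->
  `|bregman x y - bregman x y'| <= L * `|y - y'|.
Proof.
move=> a0 L0 ax ay ay' lipG2; rewrite ler_norml.
rewrite (@bregman_lip_le L _ _ _ a)// andbT lerNl opprB distrC.
exact: (@bregman_lip_le L _ _ _ a).
Qed.

End Bregman.

(** * Powers of a positive variable *)

Section PowerBregman.
Context {R : realType}.
Implicit Types (s x y a b : R).

Definition dpow s y := s * y `^ (s - 1).
Definition ddpow s y := s * (s - 1) * y `^ (s - 2).
Definition bpow s := bregman (fun y => y `^ s) (dpow s) (ddpow s).

Lemma is_derive_pow s y : 0 < y -> is_derive y 1 (fun y => y `^ s) (dpow s y).
Proof. exact: is_derive1_powR. Qed.

Lemma is_derive_dpow s y : 0 < y -> is_derive y 1 (dpow s) (ddpow s y).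
Proof.
move=> y0; rewrite /dpow /ddpow.
have ? := @is_derive1_powR _ (s - 1) y y0.
apply: is_derive_eq; rewrite /GRing.scale /= -mulrA; congr (_ * (_ * _ `^ _)).
by ring.
Qed.

Lemma powR_le0_anti s a y : s <= 0 -> 0 < a -> a <= y -> y `^ s <= a `^ s.
Proof.
move=> s0 a0 ay; have y0 := lt_le_trans a0 ay.
rewrite -[s]opprK !(powRN _ (- s)) lef_pV2 ?posrE ?powR_gt0//.
by rewrite ge0_ler_powR ?nnegrE ?oppr_ge0// ltW.
Qed.

(** Since s <= 1, the exponents s - 1, s - 2, s - 3 of the first three derivatives are nonpositive,
    so on [a, +oo[ each is bounded by its absolute value at a. The constant L is the sum of these
    three bounds. *)
Lemma bpow_bounds s a : s <= 1 -> 0 < a -> exists2 L, 0 <= L &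
  [/\ forall y, a <= y -> `|dpow s y| <= L,
      forall x y, a <= x -> a <= y -> `|bpow s x y| <= L &
      forall x y y', a <= x -> a <= y -> a <= y' ->
        `|bpow s x y - bpow s x y'| <= L * `|y - y'|].
Proof.
move=> s1 a0.
pose c (t u : R) : R := `|t| * a `^ u.
have c0 t u : 0 <= c t u by rewrite mulr_ge0// powR_ge0.
pose L := c s (s - 1) + c (s * (s - 1)) (s - 2) + c (s * (s - 1) * (s - 2)) (s - 3).
have le_c t u y : u <= 0 -> a <= y -> `|t * y `^ u| <= c t u.
  move=> u0 ay; rewrite normrM (ger0_norm (powR_ge0 _ _)) ler_wpM2l//.
  exact: powR_le0_anti.
have G2L y : a <= y -> `|ddpow s y| <= L.
  move=> ay; apply: (le_trans (le_c _ _ _ _ ay)); first by lra.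
  by rewrite /L; have := c0 s (s - 1);
    have := c0 (s * (s - 1) * (s - 2)) (s - 3); lra.
exists L; first by rewrite /L !addr_ge0.
split.
- move=> y ay; apply: (le_trans (le_c _ _ _ _ ay)); first by lra.
  by rewrite /L -addrA lerDl addr_ge0.
- move=> x y ax ay; have L0 : 0 <= L by rewrite /L !addr_ge0.
  rewrite ler_norml; apply/andP; split.
    apply: (bregman_lb (@is_derive_pow s) (@is_derive_dpow s)) => //.
    + exact: lt_le_trans ax.
    + exact: lt_le_trans ay.
    + move=> z; rewrite ge_min => xyz.
      have /G2L : a <= z by case/orP: xyz; exact: le_trans.
      by rewrite ler_norml => /andP[].
  apply: (bregman_ub (@is_derive_pow s) (@is_derive_dpow s)) => //.
  + exact: lt_le_trans ax.
  + exact: lt_le_trans ay.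
  + move=> z; rewrite ge_min => xyz.
    have /G2L : a <= z by case/orP: xyz; exact: le_trans.
    by rewrite ler_norml => /andP[].
- move=> x y y' ax ay ay'; apply: (bregman_lip (@is_derive_pow s) (@is_derive_dpow s) a0) => //.
  + by rewrite /L !addr_ge0.
  + suff H z z' : a <= z -> z <= z' -> `|ddpow s z' - ddpow s z| <= L * `|z' - z|.
      by move=> z z' az az'; case: (leP z z') => [|/ltW] zz';
        [rewrite distrC (distrC z)|]; exact: H.
    move=> az zz'.
    have [|w /andP[zw _] ->] := @mean_value _ (ddpow s)
      (fun y => s * (s - 1) * (s - 2) * y `^ (s - 3)) z z' zz'.
      move=> w /andP[zw _]; rewrite /ddpow.
      have w0 : 0 < w by rewrite (lt_le_trans a0)// (le_trans az).
      have ? := @is_derive1_powR _ (s - 2) w w0.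
      apply: is_derive_eq; rewrite /GRing.scale /= !mulrA; congr (_ * _ `^ _).
      by ring.
    rewrite normrM ler_wpM2r//.
    apply: (le_trans (le_c _ _ _ _ (le_trans az zw))); first by lra.
    by rewrite /L lerDr addr_ge0.
Qed.

Lemma bpow_le0 s x y : 0 <= s <= 1 -> 0 < x -> 0 < y -> bpow s x y <= 0.
Proof.
move=> /andP[s0 s1] x0 y0; apply: (bregman_ub (@is_derive_pow s) (@is_derive_dpow s)) => //.
move=> z _; rewrite /ddpow; have := powR_ge0 z (s - 2).
have : s * (s - 1) <= 0 by nra.
by move=> ? ?; rewrite mulr_le0_ge0.
Qed.

Lemma bpowE s x y :
  y `^ s = x `^ s + dpow s x * (y - x) + bpow s x y * (y - x) ^+ 2.
Proof. exact: (bregmanE (fun y => y `^ s)). Qed.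

Lemma powR_concave s x y : 0 <= s <= 1 -> 0 < x -> 0 < y ->
  y `^ s <= x `^ s + dpow s x * (y - x).
Proof.
move=> s01 x0 y0; rewrite [leLHS](bpowE s x y) gerDl mulr_le0_ge0 ?sqr_ge0//.
exact: bpow_le0.
Qed.

Lemma powRS x s : 0 < x -> x `^ (s + 1) = x * x `^ s.
Proof.
move=> x0; rewrite powRD; last by rewrite (gt_eqF x0) implybT.
by rewrite powRr1 ?ltW// mulrC.
Qed.

(* The trapezoid rule underestimates the integral of the concave function
   [t `^ (p - 1)] between [b] and [a]. *)
Lemma trapezoid_powR p a b : 1 <= p <= 2 -> 0 < b -> b <= a ->
  p / 2 * (a - b) * (a `^ (p - 1) + b `^ (p - 1)) <= a `^ p - b `^ p.
Proof.
move=> /andP[p1 p2] b0 ba.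
(* [Z] vanishes at b. Its derivative is p / 2 times the gap at b between t^(p-1) and its tangent
   line at the current point, which is nonnegative by concavity. *)
pose Z a := a `^ p - b `^ p - p / 2 * (a - b) * (a `^ (p - 1) + b `^ (p - 1)).
pose Z1 a := p * a `^ (p - 1) - (p / 2 * (a `^ (p - 1) + b `^ (p - 1))
  + p / 2 * (a - b) * dpow (p - 1) a).
have [|w /andP[bw _]] := @mean_value _ Z Z1 b a ba.
  move=> w /andP[bw _]; have w0 := lt_le_trans b0 bw.
  have ? := @is_derive1_powR _ p w w0.
  have ? := @is_derive1_powR _ (p - 1) w w0.
  rewrite /Z /Z1; apply: is_derive_eq; rewrite /GRing.scale /= /dpow.
  ring.
have w0 := lt_le_trans b0 bw.
rewrite {2}/Z !subrr mulr0 mul0r !subr0 -subr_ge0 /Z => ->.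
apply: mulr_ge0; last by rewrite subr_ge0.
rewrite /Z1 subr_ge0.
have p01 : 0 <= p - 1 <= 1 by lra.
by have := powR_concave p01 w0 b0; nra.
Qed.

Lemma bpow_sym s x y :
  (bpow s x y + bpow s y x) * (y - x) ^+ 2 = (dpow s y - dpow s x) * (y - x).
Proof. by have := bpowE s x y; have := bpowE s y x; lra. Qed.

(** Since a^(2q-1) = a^q a^(q-1), this is q times the mean of a^(q-1) and b^(q-1) with weights a^q
    and b^q. *)
Definition wpow (q a b : R) := q * (a `^ (2 * q - 1) + b `^ (2 * q - 1)) /
  (a `^ q + b `^ q).

(** Multiplied by (b - a)^2 and rewritten with [bpow_sym] and x * dpow q x = q x^q, the claim
    becomes L (b - a)^2 <= (b - a)(b^q - a^q). For L <= 0 this is monotonicity; for L =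
    [wpow q a b], clearing the denominator a^q + b^q leaves the trapezoid inequality with p = 2q. On
    the diagonal it reduces to L <= q a^(q-1), an equality for [wpow]. *)
Lemma bpow_sym_ge q L a b : 0 < q <= 1 -> 0 < a -> 0 < b ->
    L <= 0 \/ 1 <= 2 * q /\ L = wpow q a b ->
  2 * q * L - (dpow q a + dpow q b) <= (bpow q a b + bpow q b a) * (a + b).
Proof.
move=> /andP[q0 q1] a0 b0 LE.
wlog : a b a0 b0 LE / a <= b => [hw|].
  case: (leP a b) => [|/ltW] ab; first exact: hw.
  rewrite (addrC (dpow q a)) (addrC (bpow q a b)) (addrC a); apply: hw => //.
  by rewrite /wpow addrC (addrC (b `^ q)).
rewrite le_eqVlt => /orP[/eqP ab|ab].
  subst b; rewrite /bpow /bregman eqxx /ddpow /dpow.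
  have aq0 : 0 < a `^ (q - 1) by rewrite powR_gt0.
  have -> : a `^ (q - 2) = a `^ (q - 1) / a.
    rewrite -[q - 1](_ : (q - 2) + 1 = _); last by ring.
    by rewrite powRS// mulrAC divff ?mul1r// gt_eqF.
  have a_neq0 : a != 0 by rewrite gt_eqF.
  have -> : (q * (q - 1) * (a `^ (q - 1) / a) / 2 +
     q * (q - 1) * (a `^ (q - 1) / a) / 2) * (a + a) =
     2 * q * (q - 1) * a `^ (q - 1) by field.
  suff : L <= q * a `^ (q - 1) by nra.
  case: LE => [|[_ ->]]; first by move/le_trans; apply; rewrite mulr_ge0// ltW.
  rewrite /wpow.
  rewrite (_ : 2 * q - 1 = q + (q - 1)); last by ring.
  rewrite powRD; last by rewrite a_neq0 implybT.
  have aq : a `^ q != 0 by rewrite gt_eqF// powR_gt0.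
  by rewrite le_eqVlt; apply/orP; left; apply/eqP; field; rewrite -mulr2n mulrn_eq0.
have ba0 : 0 < (b - a) ^+ 2 by rewrite exprn_gt0// subr_gt0.
rewrite -(ler_pM2r ba0).
have -> : (bpow q a b + bpow q b a) * (a + b) * (b - a) ^+ 2 =
   (dpow q b - dpow q a) * (b - a) * (a + b).
  by rewrite -bpow_sym; ring.
have dE x : 0 < x -> x * dpow q x = q * x `^ q.
  move=> x0; rewrite /dpow mulrCA -powRS//; congr (_ * _ `^ _); ring.
suff : q * L * (b - a) ^+ 2 <= (b - a) * (b * dpow q b - a * dpow q a) by nra.
rewrite !dE// -mulrBr -[leLHS]mulrA [leRHS]mulrCA ler_pM2l//.
have abq : a `^ q <= b `^ q.
  by rewrite ge0_ler_powR ?nnegrE ?ltW.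
case: LE => [L0|[q2 ->]].
  apply: (@le_trans _ _ 0); first by rewrite mulr_le0_ge0 ?sqr_ge0.
  apply: mulr_ge0; rewrite subr_ge0 ?(ltW ab) //.
have p12 : 1 <= 2 * q <= 2 by lra.
have := trapezoid_powR p12 a0 (ltW ab).
have sqE x : x `^ (2 * q) = x `^ q ^+ 2.
  by rewrite mulrC powRrM -powR_mulrn ?powR_ge0.
have D0 : 0 < a `^ q + b `^ q by rewrite addr_gt0// powR_gt0.
rewrite !sqE /wpow => H.
rewrite -(ler_pM2r D0) [leLHS](_ : _ = (b - a) * (2 * q / 2 * (b - a) *
  (b `^ (2 * q - 1) + a `^ (2 * q - 1)))); last first.
  by field; rewrite gt_eqF.
rewrite [leRHS](_ : _ = (b - a) * ((b `^ q) ^+ 2 - (a `^ q) ^+ 2)); last by ring.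
by rewrite ler_wpM2l// subr_ge0 ltW.
Qed.

End PowerBregman.

(** * The scalar inequality behind the Laplacian *)

Section LaplacianSums.
Context {R : realType}.

(** The double sum of the products in the hypothesis expands to twice the difference of the two
    sides. *)
Lemma chebyshev_sum m (A r : 'I_m -> R) :
    (forall i k, (A i - A k) * (r i - r k) <= 0) ->
  m%:R * (\sum_i A i * r i) <= (\sum_i A i) * (\sum_i r i).
Proof.
move=> anti.
have : \sum_i \sum_k (A i - A k) * (r i - r k) <= 0.
  by apply: sumr_le0 => i _; apply: sumr_le0 => k _.
have -> : \sum_i \sum_k (A i - A k) * (r i - r k) =
    2 * (m%:R * (\sum_i A i * r i) - (\sum_i A i) * (\sum_i r i)).
  transitivity (\sum_i \sum_k (A i * r i + A k * r k - (A i * r k + r i * A k))).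
    by apply: eq_bigr => i _; apply: eq_bigr => k _; ring.
  under eq_bigr do rewrite sumrB !big_split /= sumr_const card_ord -!mulr_sumr.
  rewrite sumrB !big_split /= sumr_const card_ord sumrMnl -!mulr_suml.
  by rewrite -mulr_natl; ring.
by rewrite pmulr_rle0// subr_le0.
Qed.

(** Used with b = A r and b' = A' r', where it is the mean of r and r' with weights A and A'. *)
Let mediant (A b A' b' : R) := (b + b') / (A + A').

(** Both sides agree when the r's coincide, so their difference is a combination of r2 - r1 and r3 -
    r2; the ordering of the A's makes both coefficients nonnegative. *)
Lemma mediant_triple_sorted (A1 A2 A3 r1 r2 r3 : R) :
    0 < A3 -> A3 <= A2 -> A2 <= A1 -> r1 <= r2 -> r2 <= r3 ->
  A1 * r1 + A2 * r2 + A3 * r3 <= A3 * mediant A1 (A1 * r1) A2 (A2 * r2)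
    + A2 * mediant A1 (A1 * r1) A3 (A3 * r3)
    + A1 * mediant A2 (A2 * r2) A3 (A3 * r3).
Proof.
move=> A30 A32 A21 r12 r23; have A20 := lt_le_trans A30 A32.
have A10 := lt_le_trans A20 A21.
have n12 : A1 + A2 != 0 by rewrite gt_eqF// addr_gt0.
have n13 : A1 + A3 != 0 by rewrite gt_eqF// addr_gt0.
have n23 : A2 + A3 != 0 by rewrite gt_eqF// addr_gt0.
rewrite -subr_ge0 /mediant.
have -> : A3 * ((A1 * r1 + A2 * r2) / (A1 + A2))
    + A2 * ((A1 * r1 + A3 * r3) / (A1 + A3))
    + A1 * ((A2 * r2 + A3 * r3) / (A2 + A3)) - (A1 * r1 + A2 * r2 + A3 * r3) =
  A1 * ((A1 ^+ 2 - A2 ^+ 2 + A3 * (A2 - A3)) / ((A1 + A2) * (A1 + A3))) * (r2 - r1)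
  + A3 * ((A1 * (A1 - A2) + (A2 ^+ 2 - A3 ^+ 2)) / ((A1 + A3) * (A2 + A3)))
    * (r3 - r2).
  by field; rewrite n12 n13 n23.
have [[p1 p2] p3] := (ltW A10, ltW A20, ltW A30).
apply: addr_ge0; apply: mulr_ge0; rewrite ?subr_ge0//; apply: mulr_ge0 => //;
  (apply: divr_ge0; last by rewrite mulr_ge0// addr_ge0); apply: addr_ge0.
- by rewrite subr_ge0 lerXn2r.
- by rewrite mulr_ge0 ?subr_ge0.
- by rewrite mulr_ge0 ?subr_ge0.
- by rewrite subr_ge0 lerXn2r.
Qed.

Lemma mediant_triple (A1 A2 A3 r1 r2 r3 : R) :
    0 < A1 -> 0 < A2 -> 0 < A3 ->
    (A1 <= A2 -> r2 <= r1) -> (A2 <= A1 -> r1 <= r2) ->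
    (A1 <= A3 -> r3 <= r1) -> (A3 <= A1 -> r1 <= r3) ->
    (A2 <= A3 -> r3 <= r2) -> (A3 <= A2 -> r2 <= r3) ->
  A1 * r1 + A2 * r2 + A3 * r3 <= A3 * mediant A1 (A1 * r1) A2 (A2 * r2)
    + A2 * mediant A1 (A1 * r1) A3 (A3 * r3)
    + A1 * mediant A2 (A2 * r2) A3 (A3 * r3).
Proof.
move=> A10 A20 A30 h1 h2 h3 h4 h5 h6.
have mC A b A' b' : mediant A b A' b' = mediant A' b' A b.
  by rewrite /mediant addrC (addrC A).
have S := mediant_triple_sorted.
case: (leP A1 A2) => [|/ltW] c12; case: (leP A2 A3) => [|/ltW] c23;
  case: (leP A1 A3) => [|/ltW] c13.
- have := S A3 A2 A1 r3 r2 r1 A10 c12 c23 (h5 c23) (h1 c12).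
  by rewrite (mC A3 _ A2) (mC A3 _ A1) (mC A2 _ A1); lra.
- have := S A3 A2 A1 r3 r2 r1 A10 c12 c23 (h5 c23) (h1 c12).
  by rewrite (mC A3 _ A2) (mC A3 _ A1) (mC A2 _ A1); lra.
- have := S A2 A3 A1 r2 r3 r1 A10 c13 c23 (h6 c23) (h3 c13).
  by rewrite (mC A3 _ A1) (mC A2 _ A1); lra.
- have := S A2 A1 A3 r2 r1 r3 A30 c13 c12 (h1 c12) (h4 c13).
  by rewrite (mC A2 _ A1); lra.
- have := S A3 A1 A2 r3 r1 r2 A20 c12 c13 (h3 c13) (h2 c12).
  by rewrite (mC A3 _ A1) (mC A3 _ A2); lra.
- have := S A1 A3 A2 r1 r3 r2 A20 c23 c13 (h4 c13) (h5 c23).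
  by rewrite (mC A3 _ A2); lra.
- have := S A1 A2 A3 r1 r2 r3 A30 c23 c12 (h2 c12) (h6 c23).
  by lra.
- have := S A1 A2 A3 r1 r2 r3 A30 c23 c12 (h2 c12) (h6 c23).
  by lra.
Qed.

Lemma sum_neq (I : finType) (i : I) (c : I -> R) :
  \sum_(k | k != i) c k = \sum_k c k - c i.
Proof. by rewrite [in RHS](bigD1 i)//= addrAC subrr add0r. Qed.

Lemma sum_neq2 m (i k : 'I_m) (c : 'I_m -> R) : k != i ->
  \sum_(l | (l != i) && (l != k)) c l = \sum_l c l - c i - c k.
Proof. by move=> ki; rewrite [in RHS](bigD1 i)//= [in RHS](bigD1 k)//=; ring. Qed.

(** Distribute the factor A_l of the first sum over the mediants of the pairs (i, k). The terms with
    l in {i, k} add up to A_i r_i + A_k r_k, in total 2 (m-1) times the sum of the A_i r_i. The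
    terms with l distinct from both are grouped into triples and bounded by [mediant_triple], giving
    (m-1)(m-2) times that sum. Together this is m (m-1). *)
Lemma mediant_mean m (A r : 'I_m -> R) :
    (forall i, 0 < A i) -> (forall i k, A i <= A k -> r k <= r i) ->
  m%:R * (m%:R - 1) * (\sum_i A i * r i) <= (\sum_i A i) *
    (\sum_i \sum_(k | k != i) mediant (A i) (A i * r i) (A k) (A k * r k)).
Proof.
move=> A0 anti; set b := fun i => A i * r i.
pose w i k := mediant (A i) (b i) (A k) (b k).
rewrite -[X in _ <= _ * X]/(\sum_i \sum_(k | k != i) w i k).
have wC i k : w i k = w k i by rewrite /w /mediant addrC (addrC (A k)).
(* The indicator of distinct triples makes all three sums unrestricted, so that indices can be
   permuted freely. *)
pose D (i k l : 'I_m) : R := [&& k != i, l != i & l != k]%:R.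
have DC i k l : D i k l = D k i l.
  by rewrite /D (eq_sym i) andbA andbAC -andbA.
have DC' i k l : D i k l = D l k i.
  by rewrite /D (eq_sym i k) (eq_sym i l) (eq_sym k l) andbA andbC andbA andbAC
    -andbA andbCA.
have DE (F : 'I_m -> 'I_m -> 'I_m -> R) : \sum_i \sum_k \sum_l D i k l * F i k l =
    \sum_i \sum_(k | k != i) \sum_(l | (l != i) && (l != k)) F i k l.
  apply: eq_bigr => i _; rewrite [RHS]big_mkcond; apply: eq_bigr => k _ /=.
  rewrite [in RHS]big_mkcond /D; case: (k != i) => /=; last first.
    by rewrite big1// => l _; rewrite mul0r.
  by apply: eq_bigr => l _; case: ifP => _; rewrite (mul0r, mul1r).
have count : \sum_i \sum_k \sum_l D i k l * b i =
    (m%:R - 1) * (m%:R - 2) * \sum_i b i.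
  rewrite DE mulr_sumr; apply: eq_bigr => i _.
  transitivity (\sum_(k < m | k != i) ((m%:R - 2) * b i)).
    apply: eq_bigr => k ki; rewrite (sum_neq2 _ ki) sumr_const card_ord -mulr_natl.
    ring.
  by rewrite sum_neq sumr_const card_ord -mulr_natl; ring.
pose T := \sum_i \sum_k \sum_l D i k l * (A l * w i k).
have T2 : T = \sum_i \sum_k \sum_l D i k l * (A i * w k l).
  rewrite /T; under eq_bigr do rewrite exchange_big /=.
  rewrite exchange_big /=.
  apply: eq_bigr => i _; apply: eq_bigr => k _; apply: eq_bigr => l _.
  by rewrite DC' DC DC' DC.
have T3 : T = \sum_i \sum_k \sum_l D i k l * (A k * w i l).
  rewrite T2 exchange_big /=.
  by apply: eq_bigr => i _; apply: eq_bigr => k _; apply: eq_bigr => l _; rewrite DC.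
have count2 : \sum_i \sum_k \sum_l D i k l * b k =
    (m%:R - 1) * (m%:R - 2) * \sum_i b i.
  rewrite exchange_big -count /=.
  by apply: eq_bigr => i _; apply: eq_bigr => k _; apply: eq_bigr => l _; rewrite DC.
have count3 : \sum_i \sum_k \sum_l D i k l * b l =
    (m%:R - 1) * (m%:R - 2) * \sum_i b i.
  rewrite -count2; apply: eq_bigr => i _; rewrite exchange_big /=.
  apply: eq_bigr => k _; apply: eq_bigr => l _.
  by rewrite DC' DC DC'.
(* Three relabelings of [T] are added so that the three mediants of each triple stand side by
   side. *)
have T_ge : (m%:R - 1) * (m%:R - 2) * (\sum_i b i) <= T.
  suff : 3 * ((m%:R - 1) * (m%:R - 2) * \sum_i b i) <= 3 * T by lra.
  have -> : 3 * T = T + T + T by ring.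
  rewrite {2}T3 {2}T2 {1}/T -!big_split /=.
  have -> : 3 * ((m%:R - 1) * (m%:R - 2) * \sum_i b i) =
     \sum_i \sum_k \sum_l D i k l * (b i + b k + b l).
    rewrite (_ : 3 * _ = (m%:R - 1) * (m%:R - 2) * (\sum_i b i)
      + (m%:R - 1) * (m%:R - 2) * (\sum_i b i)
      + (m%:R - 1) * (m%:R - 2) * (\sum_i b i)); last by ring.
    rewrite -{1}count -{1}count2 -{1}count3 -!big_split /=.
    apply: eq_bigr => i _; rewrite -!big_split; apply: eq_bigr => k _ /=.
    by rewrite -!big_split; apply: eq_bigr => l _ /=; ring.
  apply: ler_sum => i _; rewrite -!big_split; apply: ler_sum => k _ /=.
  rewrite -!big_split; apply: ler_sum => l _ /=.
  rewrite -!mulrDr ler_wpM2l ?ler0n//.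
  by apply: mediant_triple => // ?; exact: anti.
rewrite [leRHS]mulr_sumr.
have -> : \sum_i (\sum_j A j) * (\sum_(k | k != i) w i k) =
    T + 2 * (m%:R - 1) * \sum_i b i.
  transitivity (\sum_i (\sum_(k | k != i) (\sum_(l | (l != i) && (l != k))
      A l * w i k + (b i + b k)))).
    apply: eq_bigr => i _; rewrite mulr_sumr; apply: eq_bigr => k ki.
    rewrite -mulr_suml (sum_neq2 _ ki) /w /mediant.
    by field; rewrite gt_eqF// addr_gt0.
  under eq_bigr do rewrite big_split /=.
  rewrite big_split /= -(DE (fun i k l => A l * w i k)); congr (_ + _).
  transitivity (\sum_(i < m) (m%:R * b i + \sum_k b k - (b i + b i))).
    apply: eq_bigr => i _; rewrite sum_neq big_split /= sumr_const card_ord.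
    by rewrite mulr_natl.
  rewrite sumrB !big_split /= sumr_const card_ord -mulr_sumr -mulr_natl; ring.
by move: T_ge; set B := \sum_i b i; nra.
Qed.

End LaplacianSums.

(** * Sign of the Laplacian in terms of the eigenvalues *)

Section LaplacianSign.
Context {R : realType}.

(* With [p = 2 * q] and [alpha = p * c], the bounds on [alpha] in cases (ii)
   and (i). *)
Definition admissible (n m : nat) (q c : R) :=
  2 * q * (c + 1) <= m%:R * (n%:R - m%:R - 1 + 2 * q) \/
  1 <= 2 * q /\ 2 * q * (c + 1) <=
    m%:R * (n%:R - m%:R - 1 + 2 * q) + q * (m%:R * (m%:R - 1)).

(** Put A = a^q and r = a^(q-1): these are oppositely ordered because q <= 1, and A r = a^(2q-1).
    [chebyshev_sum] pays for the term m (n - m - 1 + 2q) of [admissible] and [mediant_mean] for the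
    term q m (m-1). [L] is 0 in the first alternative and [wpow] in the second; the recorded
    disjunction is what [bpow_sym_ge] asks for. *)
Lemma power_sums_ineq (n m : nat) (q c : R) (a : 'I_m -> R) :
    (m <= n)%N -> 0 < q -> q <= 1 -> 0 <= c -> admissible n m q c ->
    (forall i, 0 < a i) ->
  exists2 L : 'I_m -> 'I_m -> R,
    forall i k, L i k <= 0 \/ 1 <= 2 * q /\ L i k = wpow q (a i) (a k) &
  2 * q * (c + 1) * (\sum_i a i `^ (2 * q - 1)) <=
  (\sum_i a i `^ q) * ((n%:R - m%:R - 1 + 2 * q) * (\sum_i a i `^ (q - 1)) +
    \sum_i \sum_(k | k != i) L i k).
Proof.
move=> mn q0 q1 c0 adm a0.
pose A i := a i `^ q; pose r i := a i `^ (q - 1).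
have A0 i : 0 < A i by rewrite powR_gt0.
have r0 i : 0 < r i by rewrite powR_gt0.
have anti i k : A i <= A k -> r k <= r i.
  move=> Aik; apply: powR_le0_anti => //; first by rewrite subr_le0.
  rewrite leNgt; apply: contraTN Aik; rewrite -ltNge => ki.
  by apply: gt0_ltr_powR; rewrite ?nnegrE ?ltW.
have bE i : a i `^ (2 * q - 1) = A i * r i.
  rewrite -powRD; last by rewrite (gt_eqF (a0 i)) implybT.
  by congr (_ `^ _); ring.
under eq_bigr do rewrite bE.
have cheb : m%:R * (\sum_i A i * r i) <= (\sum_i A i) * (\sum_i r i).
  apply: chebyshev_sum => i k; case: (leP (A i) (A k)) => [|/ltW] Aik;
    have := anti _ _ Aik => rki; nra.
set kap := n%:R - m%:R - 1 + 2 * q in adm *.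
have mean := mediant_mean A0 anti.
rewrite -/(\sum_i A i) -/(\sum_i r i).
have SA0 : 0 <= \sum_i A i by apply: sumr_ge0 => i _; exact: ltW.
have B0 : 0 <= \sum_i A i * r i.
  by apply: sumr_ge0 => i _; rewrite mulr_ge0 ?ltW.
set B := \sum_i A i * r i in cheb mean B0 *.
set SA := \sum_i A i in cheb mean SA0 *; set Sr := \sum_i r i in cheb *.
case: adm => [adm|[q2 adm]].
  exists (fun _ _ => 0); first by left.
  rewrite big1 ?addr0; last by move=> i _; rewrite big1.
  have m0 : 0 <= m%:R :> R by [].
  (* Here the sign of [kap] comes from the bound itself, whose left side is positive. *)
  have kap0 : 0 <= kap.
    have : 0 < m%:R * kap by apply: lt_le_trans adm; rewrite !mulr_gt0//; lra.
    by rewrite leNgt => h; apply/negP => k0; nra.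
  apply: le_trans (ler_wpM2r B0 adm) _.
  by rewrite [_ * kap]mulrC -mulrA [leRHS]mulrCA ler_wpM2l.
exists (fun i k => wpow q (a i) (a k)); first by right.
have mnR : m%:R <= n%:R :> R by rewrite ler_nat.
have kap0 : 0 <= kap by rewrite /kap; lra.
have -> : \sum_(i < m) \sum_(k < m | k != i) wpow q (a i) (a k) =
   q * (\sum_(i < m) \sum_(k < m | k != i) (A i * r i + A k * r k) / (A i + A k)).
  rewrite mulr_sumr; apply: eq_bigr => i _; rewrite mulr_sumr.
  by apply: eq_bigr => k _; rewrite /wpow !bE mulrA.
rewrite [leRHS]mulrDr [SA * (q * _)]mulrCA [SA * (kap * _)]mulrCA.
apply: le_trans (ler_wpM2r B0 adm) _; rewrite mulrDl; apply: lerD.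
  by rewrite [_ * kap]mulrC -mulrA ler_wpM2l.
by rewrite -mulrA ler_wpM2l// ltW.
Qed.

(** Here x stands for the eigenvalues of X^T X and a = x + e. Replacing x by a raises the left side
    and lowers the right one, as [bpow] is nonpositive for exponents in [0, 1]; what remains is
    homogeneous in a and follows from [power_sums_ineq]. *)
Lemma laplacian_sign (n m : nat) (q c : R) (a x : 'I_m -> R) :
    (m <= n)%N -> 0 < q -> q <= 1 -> 0 <= c -> admissible n m q c ->
    (forall i, 0 < a i) -> (forall i, 0 <= x i <= a i) ->
  2 * (c + 1) * (\sum_i dpow q (a i) ^+ 2 * x i) <=
  (\sum_i a i `^ q) * (n%:R * (\sum_i dpow q (a i)) +
    \sum_i \sum_k bpow q (a i) (a k) * (x i + x k + (2 * x i) *+ (i == k))).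
Proof.
move=> mn q0 q1 c0 adm a0 xa.
have [L LE main] := power_sums_ineq mn q0 q1 c0 adm a0.
have q01 : 0 < q <= 1 by rewrite q0.
have q01' : 0 <= q <= 1 by rewrite ltW.
have SA0 : 0 <= \sum_i a i `^ q by apply: sumr_ge0 => i _; exact: powR_ge0.
apply: (@le_trans _ _ (2 * (c + 1) * (\sum_i dpow q (a i) ^+ 2 * a i))).
  rewrite ler_wpM2l//; first by lra.
  apply: ler_sum => i _; rewrite ler_wpM2l ?sqr_ge0//.
  by have /andP[] := xa i.
apply: (@le_trans _ _ ((\sum_i a i `^ q) * (n%:R * (\sum_i dpow q (a i)) +
    \sum_i \sum_k bpow q (a i) (a k) * (a i + a k + (2 * a i) *+ (i == k)))));
    last first.
  rewrite ler_wpM2l// lerD2l; apply: ler_sum => i _; apply: ler_sum => k _.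
  rewrite -subr_ge0 -mulrBr mulr_le0 ?bpow_le0//.
  have /andP[_ xi] := xa i; have /andP[_ xk] := xa k.
  by case: (i == k); rewrite ?mulr1n ?mulr0n; lra.
have -> : 2 * (c + 1) * (\sum_i dpow q (a i) ^+ 2 * a i) =
    q * (2 * q * (c + 1) * (\sum_i a i `^ (2 * q - 1))).
  rewrite !mulr_sumr; apply: eq_bigr => i _; rewrite /dpow.
  rewrite (_ : 2 * q - 1 = (q - 1) + (q - 1) + 1); last by ring.
  rewrite powRS// [_ `^ (q - 1 + _)]powRD; last by rewrite (gt_eqF (a0 i)) implybT.
  ring.
apply: le_trans (ler_wpM2l (ltW q0) main) _.
rewrite mulrCA ler_wpM2l//.
have diag i : bpow q (a i) (a i) * (2 * a i) = (q - 1) * dpow q (a i).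
  rewrite /bpow /bregman eqxx /ddpow /dpow.
  rewrite (_ : q - 1 = q - 2 + 1); last by ring.
  by rewrite powRS//; field.
pose Y i k := (bpow q (a i) (a k) + bpow q (a k) (a i)) * (a i + a k).
(* The diagonal contributes 2 (q - 1) times the sum of the [dpow]; off the diagonal the two orders
   of a pair merge into [Y], which is what [bpow_sym_ge] bounds. *)
have -> : \sum_i \sum_k bpow q (a i) (a k) * (a i + a k + (2 * a i) *+ (i == k)) =
   2 * (q - 1) * (\sum_i dpow q (a i)) + 2^-1 * \sum_i \sum_(k | k != i) Y i k.
  transitivity (\sum_i \sum_k bpow q (a i) (a k) * (a i + a k)
      + (q - 1) * \sum_i dpow q (a i)).
    rewrite mulr_sumr -big_split; apply: eq_bigr => i _ /=.
    rewrite -diag [in LHS](bigD1 i)//= [in RHS](bigD1 i)//= eqxx mulr1n.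
    rewrite mulrDr addrAC; congr (_ + _ + _); apply: eq_bigr => k ki.
    by rewrite eq_sym (negbTE ki) mulr0n addr0.
  have E : \sum_i \sum_k Y i k =
      2 * \sum_i \sum_k bpow q (a i) (a k) * (a i + a k).
    transitivity (\sum_i \sum_k bpow q (a i) (a k) * (a i + a k) +
                  \sum_i \sum_k bpow q (a k) (a i) * (a k + a i)).
      rewrite -big_split; apply: eq_bigr => i _ /=.
      by rewrite -big_split; apply: eq_bigr => k _ /=; rewrite /Y; ring.
    by rewrite [X in _ + X]exchange_big /=; ring.
  have -> : \sum_i \sum_(k | k != i) Y i k =
      \sum_i \sum_k Y i k - 2 * (q - 1) * \sum_i dpow q (a i).
    rewrite mulr_sumr -sumrB; apply: eq_bigr => i _; rewrite sum_neq; congr (_ - _).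
    by rewrite -mulrA -diag /Y; ring.
  by rewrite E; field.
have -> : \sum_i a i `^ (q - 1) = q^-1 * \sum_i dpow q (a i).
  by rewrite mulr_sumr; apply: eq_bigr => i _; rewrite /dpow mulKf// gt_eqF.
(* Half of this loss is m - 1 times the sum of the [dpow]. With the diagonal part, the coefficient n
   becomes n + 2 (q - 1) - (m - 1) = n - m - 1 + 2q. *)
have Yge : 2 * q * (\sum_i \sum_(k | k != i) L i k)
    - 2 * (m%:R - 1) * \sum_i dpow q (a i) <= \sum_i \sum_(k | k != i) Y i k.
  have -> : 2 * (m%:R - 1) * \sum_i dpow q (a i) =
      \sum_i \sum_(k | k != i) (dpow q (a i) + dpow q (a k)).
    transitivity (\sum_(i < m) ((m%:R - 2) * dpow q (a i) + \sum_k dpow q (a k))).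
      rewrite big_split /= sumr_const card_ord.
      rewrite -(mulr_sumr _ xpredT (fun i => dpow q (a i))); ring.
    apply: eq_bigr => i _; rewrite sum_neq big_split /= sumr_const card_ord.
    ring.
  rewrite mulr_sumr -sumrB; apply: ler_sum => i _.
  rewrite mulr_sumr -sumrB; apply: ler_sum => k _.
  exact: bpow_sym_ge.
have qV : q * q^-1 = 1 by rewrite divff// gt_eqF.
move: Yge; set D := \sum_i dpow q (a i).
set Z := \sum_i _; set W := \sum_i _ => Yge.
rewrite mulrDr mulrCA [q * (q^-1 * _)]mulrA qV mul1r; lra.
Qed.

End LaplacianSign.

(** * Singular values and real spectral decompositions *)

Section Spectral.
Context {R : realType}.

Lemma row_sqrE m (v : 'rV[R]_m) : v *m v^T = (\sum_i v 0 i ^+ 2)%:M.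
Proof.
apply/matrixP => i j; rewrite !ord1 !mxE eqxx mulr1n.
by apply: eq_bigr => k _; rewrite mxE expr2.
Qed.

Lemma row_sqr_gt0 m (v : 'rV[R]_m) : v != 0 -> 0 < \sum_i v 0 i ^+ 2.
Proof.
move=> v0; rewrite lt_def sumr_ge0 ?andbT => [|i _]; last exact: sqr_ge0.
apply: contra_neq v0 => /eqP; rewrite psumr_eq0 => [/allP h|i _]; last exact: sqr_ge0.
apply/rowP => i; rewrite mxE; apply/eqP.
by rewrite -sqrf_eq0; apply: h; rewrite mem_index_enum.
Qed.

(** The reflection along v - e_0 exchanges e_0 and v, both of length 1; if v = e_0 the identity
    serves. *)
Lemma householder m (v : 'rV[R]_m.+1) : v *m v^T = 1%:M ->
  exists2 Q : 'M[R]_m.+1, Q^T *m Q = 1%:M & delta_mx 0 0 *m Q = v.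
Proof.
move=> v1; have [->|ve] := eqVneq v (delta_mx 0 0).
  by exists 1%:M; rewrite ?trmx1 mulmx1.
have [w wE] : exists w, w = v - delta_mx 0 0 by exists (v - delta_mx 0 0).
have w0 : w != 0 by rewrite wE subr_eq0.
have := row_sqr_gt0 w0; set W := \sum_i _ => W0.
have wW : w *m w^T = W%:M by rewrite row_sqrE.
have WE : W = 2 - 2 * v 0 0.
  have : \sum_i v 0 i ^+ 2 = 1.
    have := congr1 (fun M : 'M[R]_(1, 1) => M 0 0) v1.
    by rewrite row_sqrE !mxE eqxx mulr1n.
  rewrite (bigD1 ord0)//= => vv; rewrite /W (bigD1 ord0)//=.
  have -> : \sum_(i < m.+1 | i != ord0) w 0 i ^+ 2 = \sum_(i < m.+1 | i != ord0) v 0 i ^+ 2.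
    by apply: eq_bigr => i /negbTE i0; rewrite wE !mxE i0 andbF subr0.
  by rewrite wE !mxE eqxx /=; lra.
have Qt : (1%:M - (2 / W) *: (w^T *m w))^T = 1%:M - (2 / W) *: (w^T *m w).
  by rewrite linearB linearZ /= trmx1 trmx_mul trmxK.
exists (1%:M - (2 / W) *: (w^T *m w)).
  rewrite Qt mulmxBl mul1mx mulmxBr mulmx1.
  rewrite -scalemxAl -scalemxAr -[w^T *m w *m _]mulmxA [w *m (w^T *m w)]mulmxA wW.
  rewrite mul_scalar_mx -scalemxAr !scalerA.
  rewrite (_ : 2 / W * (2 / W * W) = 2 / W + 2 / W); last first.
    by field; rewrite gt_eqF.
  by rewrite scalerDl opprB addrK subrK.
rewrite mulmxBr mulmx1 -scalemxAr mulmxA.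
have -> : delta_mx 0 0 *m w^T = (v 0 0 - 1)%:M :> 'M[R]_(1, 1).
  apply/matrixP => i j; rewrite !ord1 mxE (bigD1 0)//= big1 => [|k k0].
    by rewrite wE !mxE !eqxx addr0 mul1r.
  by rewrite !mxE (negbTE k0) mul0r.
rewrite mul_scalar_mx scalerA (_ : 2 / W * _ = -1).
  by rewrite scaleN1r opprK wE addrC subrK.
by rewrite WE; field; rewrite -WE gt_eqF.
Qed.

(** Induction on the dimension: a unit eigenvector for the first root is moved to e_0 by
    [householder], symmetry splits off a 1 x 1 block, and cancelling one linear factor shows that
    the remaining block again has a split characteristic polynomial. For X^T X the real roots are
    the squared singular values. *)
Lemma symmetric_diagonalization m (A : 'M[R]_m) (s : seq R) :
    A^T = A -> char_poly A = \prod_(x <- s) ('X - x%:P) ->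
  exists (U : 'M[R]_m) (d : 'rV[R]_m), U^T *m U = 1%:M /\ A = U *m diag_mx d *m U^T.
Proof.
elim: m A s => [|m IH] A s At As.
  by exists 1%:M, 0; rewrite !flatmx0; split; [|]; apply/matrixP => -[].
case: s As => [|a s] As.
  have := size_char_poly A; rewrite As big_nil size_poly1 => /eqP.
  by rewrite eqSS.
have /eigenvalueP[u uA u0] : eigenvalue A a.
  by rewrite eigenvalue_root_char As big_cons rootM root_XsubC eqxx.
have N0 := row_sqr_gt0 u0; set N := \sum_i _ in N0.
pose v := (Num.sqrt N)^-1 *: u.
have v1 : v *m v^T = 1%:M.
  rewrite /v linearZ /= -scalemxAl -scalemxAr scalerA row_sqrE -/N.
  rewrite -invfM -expr2 sqr_sqrtr ?ltW// scale_scalar_mx mulVf// gt_eqF//.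
have vA : v *m A = a *: v by rewrite /v -scalemxAl uA !scalerA mulrC.
have [Q QQ Qv] := householder v1.
have QQ' : Q *m Q^T = 1%:M by exact: mulmx1C.
have [B BQ] : exists B : 'M[R]_(1 + m), B = Q *m A *m Q^T by exists (Q *m A *m Q^T).
have Bt : B^T = B by rewrite BQ !trmx_mul trmxK At mulmxA.
have rowB : delta_mx 0 0 *m B = a *: delta_mx 0 0 :> 'rV[R]_(1 + m).
  rewrite BQ !mulmxA Qv vA -scalemxAl -Qv; congr (_ *: _).
  by rewrite -mulmxA QQ' mulmx1.
have B0j j : B 0 j = a * (j == 0)%:R.
  have := congr1 (fun M : 'rV[R]_(1 + m) => M 0 j) rowB; rewrite -rowE !mxE => ->.
  by rewrite eqxx.
pose A1 := drsubmx B.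
have BE : B = block_mx a%:M 0 0 A1.
  rewrite -[LHS]submxK; congr block_mx; apply/matrixP => i j.
  - by rewrite !ord1 !mxE lshift0 B0j eqxx mulr1 mulr1n.
  - by rewrite !ord1 !mxE lshift0 B0j mulr0.
  - by rewrite !ord1 -Bt !mxE lshift0 B0j mulr0.
have A1t : A1^T = A1 by rewrite /A1 trmx_drsub Bt.
have A1s : char_poly A1 = \prod_(x <- s) ('X - x%:P).
  have charB : char_poly B = char_poly A.
    rewrite BQ -[X in X *m A](_ : invmx Q^T = _).
      by apply: char_poly_conjugate; rewrite unitmx_tr; case: (mulmx1_unit QQ').
    have Qtu : Q^T \in unitmx by case: (mulmx1_unit QQ').
    by rewrite -[LHS]mulmx1 -QQ mulKmx.
  apply: (@mulfI _ ('X - a%:P)); first by rewrite polyXsubC_eq0.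
  transitivity (char_poly B); last by rewrite charB As big_cons.
  rewrite BE /char_poly.
  have -> : char_poly_mx (block_mx a%:M 0 0 A1 : 'M[R]_(1 + m)) =
      block_mx ('X - a%:P)%:M 0 0 (char_poly_mx A1) :> 'M[{poly R}]_(1 + m).
    rewrite /char_poly_mx map_block_mx !map_mx0 map_scalar_mx scalar_mx_block.
    by rewrite opp_block_mx add_block_mx !oppr0 !addr0 -raddfB.
  by rewrite det_ublock det_scalar expr1.
have [U1 [d1 [U1o A1E]]] := IH A1 s A1t A1s.
pose C : 'M[R]_(1 + m) := block_mx 1%:M 0 0 U1.
have CC : C^T *m C = 1%:M.
  rewrite /C tr_block_mx !trmx0 trmx1 mulmx_block !mulmx0 !mul0mx !addr0 add0r U1o.
  by rewrite mulmx1 -scalar_mx_block.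
have BC : B = C *m diag_mx (row_mx a%:M d1) *m C^T.
  rewrite BE /C diag_mx_row tr_block_mx !trmx0 trmx1 !mulmx_block.
  rewrite !mulmx0 !mul0mx !addr0 !add0r mul1mx mulmx1 A1E.
  rewrite !mul0mx; congr block_mx; apply/matrixP => i j; rewrite !ord1 !mxE.
  by rewrite eqxx.
exists (Q^T *m C), (row_mx a%:M d1 : 'rV[R]_(1 + m)); split.
  by rewrite trmx_mul trmxK mulmxA -[_ *m Q *m _]mulmxA QQ' mulmx1 CC.
transitivity (Q^T *m B *m Q).
  by rewrite BQ !mulmxA QQ mul1mx -mulmxA QQ mulmx1.
by rewrite BC trmx_mul trmxK !mulmxA.
Qed.

Definition spectral_sum n m (G : R -> R) (X : 'M[R]_(n, m)) : R :=
  \sum_(i < m) G (tnth (singular_values X) i ^+ 2).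

(** The characteristic polynomial determines the eigenvalues with multiplicity, so every orthonormal
    eigenbasis, in any order, computes the same sum. This leaves the choice of basis free in all
    later estimates. *)
Lemma spectral_sumE n m (G : R -> R) (X : 'M[R]_(n, m)) (U : 'M[R]_m) (d : 'rV[R]_m) :
    U^T *m U = 1%:M -> X^T *m X = U *m diag_mx d *m U^T ->
  spectral_sum G X = \sum_(i < m) G (d 0 i).
Proof.
move=> UU XX; have [_ _ sE] := singular_valuesP X.
have UU' : U *m U^T = 1%:M by exact: mulmx1C.
have Uu : U^T \in unitmx by case: (mulmx1_unit UU).
have UV : invmx U^T = U by rewrite -[LHS]mulmx1 -UU mulKmx.
have dE : char_poly (X^T *m X) = \prod_(i < m) ('X - (d 0 i)%:P).
  rewrite XX -{1}UV char_poly_conjugate// char_poly_trig ?diag_mx_is_trig//.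
  by apply: eq_bigr => i _; rewrite !mxE eqxx mulr1n.
pose t := [seq x ^+ 2 | x <- singular_values X].
pose r := [seq d 0 i | i <- index_enum 'I_m].
have : perm_eq t r.
  by apply: prod_XsubC_eq; rewrite !big_map -sE dE.
move=> tr; rewrite /spectral_sum.
rewrite -(big_tuple _ _ (singular_values X) xpredT (fun x => G (x ^+ 2))).
rewrite -(big_map (fun x => x ^+ 2) xpredT G) (perm_big _ tr) big_map.
by [].
Qed.

Lemma spectral_decomposition n m (X : 'M[R]_(n, m)) :
  exists (U : 'M[R]_m) (d : 'rV[R]_m),
    [/\ U^T *m U = 1%:M, X^T *m X = U *m diag_mx d *m U^T & forall i, 0 <= d 0 i].
Proof.
have [_ _ sE] := singular_valuesP X.
have [||U [d [UU XX]]] := @symmetric_diagonalization m (X^T *m X)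
    [seq x ^+ 2 | x <- singular_values X].
- by rewrite trmx_mul trmxK.
- by rewrite sE big_map.
exists U, d; split => // i.
have : (X *m U)^T *m (X *m U) = diag_mx d.
  by rewrite trmx_mul -mulmxA (mulmxA X^T) XX !mulmxA UU mul1mx -mulmxA UU mulmx1.
move/(congr1 (fun M : 'M[R]_(m, m) => M i i)).
rewrite [in RHS]mxE eqxx mulr1n => <-; rewrite mxE sumr_ge0// => k _.
by rewrite [X in X * _]mxE -expr2 sqr_ge0.
Qed.

End Spectral.

(** * Second-order expansion of spectral sums *)

Section Orthogonal.
Context {R : realType}.

Lemma orthogonal_sum m (P : 'M[R]_m) i k : P *m P^T = 1%:M ->
  \sum_j P i j * P k j = (i == k)%:R.
Proof.
move=> PP; have := congr1 (fun M : 'M[R]_(m, m) => M i k) PP.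
rewrite mxE [in RHS]mxE => <-; apply: eq_bigr => j _.
by rewrite [P^T j k]mxE.
Qed.

Lemma orthogonal_le1 m (P : 'M[R]_m) i j : P *m P^T = 1%:M -> `|P i j| <= 1.
Proof.
move=> PP; rewrite -(@expr_le1 _ 2)// real_normK ?num_real//.
have /esym := orthogonal_sum i i PP; rewrite eqxx mulr1n => ->.
rewrite (bigD1 j)//= -expr2 lerDl sumr_ge0// => k _.
by rewrite -expr2 sqr_ge0.
Qed.

Variables (g g1 : R -> R) (h : R -> R -> R) (L : R).
Hypothesis L0 : 0 <= L.
Hypothesis gE : forall x y, 0 <= x -> 0 <= y ->
  g y = g x + g1 x * (y - x) + h x y * (y - x) ^+ 2.
Hypothesis h_lip : forall x y y', 0 <= x -> 0 <= y -> 0 <= y' ->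
  `|h x y - h x y'| <= L * `|y - y'|.

(** [F] is the change of the Gram matrix in the basis U, and P = U^T W satisfies (F P)_ij = P_ij
    (y_j - x_i). The exact expansion has weights h(x_i, y_j); replacing them by h(x_i, x_k) costs L
    |y_j - x_k|, and the factor P_kj beside it turns this into an entry of F P, hence into a third
    factor N. So x_k and y_j need not be close where P_kj is small. *)
Lemma spectral_sum_expansion n m (X Y : 'M[R]_(n, m)) (U W : 'M[R]_m)
    (x y : 'rV[R]_m) (F := U^T *m (Y^T *m Y - X^T *m X) *m U)
    (N := \sum_i \sum_k `|F i k|) :
    U^T *m U = 1%:M -> X^T *m X = U *m diag_mx x *m U^T -> (forall i, 0 <= x 0 i) ->
    W^T *m W = 1%:M -> Y^T *m Y = W *m diag_mx y *m W^T -> (forall i, 0 <= y 0 i) ->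
  `|spectral_sum g Y - (spectral_sum g X + \sum_i g1 (x 0 i) * F i i
     + \sum_i \sum_k h (x 0 i) (x 0 k) * F i k ^+ 2)| <= m%:R ^+ 4 * L * N ^+ 3.
Proof.
move=> UU XX x0 WW YY y0.
have UU' : U *m U^T = 1%:M by exact: mulmx1C.
have WW' : W *m W^T = 1%:M by exact: mulmx1C.
have [P PE] : exists P, P = U^T *m W by exists (U^T *m W).
have PP : P *m P^T = 1%:M.
  by rewrite PE trmx_mul trmxK mulmxA -(mulmxA U^T) WW' mulmx1.
have PP' : P^T *m P^T^T = 1%:M by rewrite trmxK; exact: mulmx1C.
have PsumC j k : \sum_i P i j * P i k = (j == k)%:R.
  rewrite -(orthogonal_sum j k PP'); apply: eq_bigr => i _.
  by rewrite ![P^T _ _]mxE.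
have FP i j : (F *m P) i j = P i j * (y 0 j - x 0 i).
  have -> : F *m P = P *m diag_mx y - diag_mx x *m P.
    rewrite /F mulmxBr mulmxBl mulmxBl XX YY PE.
    rewrite !mulmxA -[_ *m U *m U^T]mulmxA UU' mulmx1.
    rewrite -!mulmxA WW mulmx1 !mulmxA UU mul1mx.
    by rewrite -[_ *m U *m U^T]mulmxA UU' mulmx1.
  rewrite mxE [in X in _ + X]mxE mul_mx_diag mul_diag_mx !mxE; ring.
have FE (i k : 'I_m) : F i k = \sum_j P i j * (y 0 j - x 0 i) * P k j.
  have -> : F i k = (F *m P *m P^T) i k by rewrite -mulmxA PP mulmx1.
  by rewrite mxE; apply: eq_bigr => j _; rewrite FP [P^T _ _]mxE.
have N0 : 0 <= N by apply: sumr_ge0 => i _; exact: sumr_ge0.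
have FN i k : `|F i k| <= N.
  rewrite /N (bigD1 i)//= (bigD1 k)//= -addrA lerDl addr_ge0 ?sumr_ge0// => j _.
  exact: sumr_ge0.
have FPN i j : `|P i j * (y 0 j - x 0 i)| <= N.
  rewrite -FP mxE; apply: le_trans (ler_norm_sum _ _ _) _.
  apply: (@le_trans _ _ (\sum_k `|F i k|)); last first.
    rewrite /N [leRHS](bigD1 i)//= lerDl.
    by apply: sumr_ge0 => ? _; exact: sumr_ge0.
  apply: ler_sum => k _; rewrite normrM ler_piMr//.
  exact: orthogonal_le1.
rewrite (spectral_sumE g WW YY) (spectral_sumE g UU XX).
(* Expanding ((F P)_ij)^2 gives a sum over k and l, and orthogonality of the rows of P lets h(x_i,
   x_k) be inserted under the same four sums. The bound is then termwise, whence the factor m^4. *)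
have -> : \sum_i g (y 0 i) - (\sum_i g (x 0 i) + \sum_i g1 (x 0 i) * F i i
     + \sum_i \sum_k h (x 0 i) (x 0 k) * F i k ^+ 2) =
   \sum_i \sum_k \sum_l \sum_j F i k * F i l *
     (P k j * P l j * (h (x 0 i) (y 0 j) - h (x 0 i) (x 0 k))).
  have -> : \sum_i g (y 0 i) = \sum_i \sum_j P i j ^+ 2 * g (y 0 j).
    rewrite exchange_big; apply: eq_bigr => j _ /=; rewrite -mulr_suml.
    by rewrite (PsumC j j) eqxx mul1r.
  have -> : \sum_i g (x 0 i) = \sum_i \sum_j P i j ^+ 2 * g (x 0 i).
    apply: eq_bigr => i _ /=; rewrite -mulr_suml.
    by rewrite (orthogonal_sum i i PP) eqxx mul1r.
  rewrite -!big_split -sumrB; apply: eq_bigr => i _ /=.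
  have -> : \sum_j P i j ^+ 2 * g (y 0 j) = \sum_j P i j ^+ 2 * g (x 0 i) +
      g1 (x 0 i) * F i i + \sum_j (F *m P) i j ^+ 2 * h (x 0 i) (y 0 j).
    rewrite FE mulr_sumr -!big_split; apply: eq_bigr => j _ /=.
    by rewrite FP (gE (x0 i) (y0 j)); ring.
  rewrite opprD addrACA subrr add0r.
  have -> : \sum_j (F *m P) i j ^+ 2 * h (x 0 i) (y 0 j) =
      \sum_k \sum_l \sum_j F i k * F i l * (P k j * P l j * h (x 0 i) (y 0 j)).
    under [RHS]eq_bigr do rewrite exchange_big.
    rewrite exchange_big; apply: eq_bigr => j _ /=.
    rewrite mxE expr2 mulr_suml mulr_suml; apply: eq_bigr => k _.
    rewrite mulr_sumr mulr_suml; apply: eq_bigr => l _; ring.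
  rewrite -sumrB; apply: eq_bigr => k _.
  have -> : h (x 0 i) (x 0 k) * F i k ^+ 2 =
      \sum_l \sum_j F i k * F i l * (P k j * P l j * h (x 0 i) (x 0 k)).
    rewrite (bigD1 k)//= [X in _ + X]big1 ?addr0 => [|l lk].
      rewrite -mulr_sumr -mulr_suml (orthogonal_sum k k PP) eqxx mulr1n; ring.
    by rewrite -mulr_sumr -mulr_suml (orthogonal_sum k l PP) eq_sym (negbTE lk);
      rewrite mul0r mulr0.
  rewrite -sumrB; apply: eq_bigr => l _; rewrite -sumrB; apply: eq_bigr => j _.
  ring.
have bound (i k l j : 'I_m) : `|F i k * F i l *
     (P k j * P l j * (h (x 0 i) (y 0 j) - h (x 0 i) (x 0 k)))| <= L * N ^+ 3.
  rewrite (_ : L * N ^+ 3 = N * N * (1 * (L * N))); last by ring.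
  rewrite !normrM; apply: ler_pM; rewrite ?mulr_ge0//.
    by apply: ler_pM.
  rewrite mulrAC mulrC; apply: ler_pM; rewrite ?mulr_ge0//.
    exact: orthogonal_le1.
  apply: le_trans (ler_wpM2l (normr_ge0 _) (h_lip (x0 i) (y0 j) (x0 k))) _.
  by rewrite mulrCA ler_wpM2l// -normrM.
have sum_bound (u : 'I_m -> R) (K : R) : (forall i, `|u i| <= K) ->
    `|\sum_i u i| <= m%:R * K.
  move=> uK; apply: le_trans (ler_norm_sum _ _ _) _.
  apply: (@le_trans _ _ (\sum_(i < m) K)); first exact: ler_sum.
  by rewrite sumr_const card_ord mulr_natl.
rewrite (_ : _ * L * _ = m%:R * (m%:R * (m%:R * (m%:R * (L * N ^+ 3))))); last by ring.
do 4 (apply: (sum_bound) => ?).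
exact: bound.
Qed.

End Orthogonal.

(** * Orders of magnitude with uniform constants *)

Section UniformOrder.
Context {R : realType} {T : Type} (w : T -> R).
Hypothesis w01 : forall z, 0 <= w z <= 1.

(** A non-asymptotic u = O(w^k): one constant serves the whole index type. Below, that type ranges
    over all base points in a ball, all increments and all choices of eigenbases at once. *)
Definition of_order (k : nat) (u : T -> R) :=
  exists2 K, 0 <= K & forall z, `|u z| <= K * w z ^+ k.

Lemma of_order0 (u : T -> R) (K : R) : (forall z, `|u z| <= K) -> of_order 0 u.
Proof.
move=> uK; exists `|K| => // z; rewrite expr0 mulr1.
exact: le_trans (uK z) (ler_norm _).
Qed.

Lemma of_order_eq k (u v : T -> R) : u =1 v -> of_order k u -> of_order k v.
Proof. by move=> uv [K K0 uK]; exists K => // z; rewrite -uv. Qed.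

Lemma of_orderW k l (u : T -> R) : (l <= k)%N -> of_order k u -> of_order l u.
Proof.
move=> lk [K K0 uK]; exists K => // z; apply: le_trans (uK z) _.
by rewrite ler_wpM2l//; have /andP[w0 w1] := w01 z; exact: ler_wiXn2l.
Qed.

Lemma of_orderD k (u v : T -> R) : of_order k u -> of_order k v ->
  of_order k (fun z => u z + v z).
Proof.
move=> [K K0 uK] [L L0 vL]; exists (K + L); first exact: addr_ge0.
move=> z; rewrite mulrDl; apply: le_trans (ler_normD _ _) _; exact: lerD.
Qed.

Lemma of_orderM k l (u v : T -> R) : of_order k u -> of_order l v ->
  of_order (k + l) (fun z => u z * v z).
Proof.
move=> [K K0 uK] [L L0 vL]; exists (K * L); first exact: mulr_ge0.
by move=> z; rewrite normrM exprD mulrACA; apply: ler_pM.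
Qed.

Lemma of_order_sum k (I : finType) (u : I -> T -> R) :
  (forall i, of_order k (u i)) -> of_order k (fun z => \sum_i u i z).
Proof.
move=> uO; have [K KP] := choice (fun i => (exists2P _ _).1 (uO i)).
exists (\sum_i K i); first by apply: sumr_ge0 => i _; case: (KP i).
move=> z; apply: le_trans (ler_norm_sum _ _ _) _; rewrite mulr_suml.
by apply: ler_sum => i _; case: (KP i).
Qed.

Lemma of_order_norm k (u : T -> R) : of_order k u -> of_order k (fun z => `|u z|).
Proof. by move=> [K K0 uK]; exists K => // z; rewrite normr_id. Qed.

Lemma of_order_le k (u v : T -> R) : (forall z, `|u z| <= v z) ->
  of_order k v -> of_order k u.
Proof.
move=> uv [K K0 vK]; exists K => // z; apply: le_trans (uv z) _.
exact: le_trans (ler_norm _) (vK z).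
Qed.

End UniformOrder.

(** The norm of a matrix is here its largest absolute entry; the Frobenius norm enters only through
    [sqnorm] and the sphere measure. *)
Lemma mx_entry_le (R : realType) n m (M : 'M[R]_(n, m)) i j : `|M i j| <= `|M|.
Proof.
rewrite [leRHS]/Num.norm /= mx_normrE.
exact: (le_bigmax _ (fun ij => `|M ij.1 ij.2|) (i, j)).
Qed.

(** * Taylor forms of the regularized prior and their traces *)

Section TaylorForms.
Context {R : realType} {n m : nat}.
Variables (q e c : R) (X : 'M[R]_(n, m)) (U : 'M[R]_m) (x : 'rV[R]_m).
Implicit Types H : 'M[R]_(n, m).

(** The part linear in H of the change of the Gram matrix from X to X + H, written in the eigenbasis
    U. *)
Definition cross H : 'M[R]_m :=
  (X *m U)^T *m (H *m U) + (H *m U)^T *m (X *m U).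

Definition sum_d1 H : R := \sum_i dpow q (x 0 i + e) * cross H i i.

(** Polarized second-order term: the first sum comes from the H^T H part of the Gram matrix, the
    second from the squares of the linear part. On the diagonal it is the Taylor term itself, so
    half the Hessian. *)
Definition sum_d2 H H' : R :=
  \sum_i dpow q (x 0 i + e) * ((H *m U)^T *m (H' *m U)) i i +
  \sum_i \sum_k bpow q (x 0 i + e) (x 0 k + e) * (cross H i k * cross H' i k).

Definition prior_d1 (S : R) H : R := dpow (- c) S * sum_d1 H.

Definition prior_d2 (S : R) H H' : R :=
  dpow (- c) S * sum_d2 H H' + ddpow (- c) S / 2 * sum_d1 H * sum_d1 H'.

Lemma cross_linear : linear cross.
Proof.
move=> a H H'; rewrite /cross mulmxDl -scalemxAl mulmxDr -scalemxAr.
rewrite [(_ + _)^T]linearD /= [(_ *: _)^T]linearZ /= [X in _ + X]mulmxDl.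
by rewrite -scalemxAl addrACA scalerDr.
Qed.

Lemma sum_d1_linear : scalar sum_d1.
Proof.
move=> a H H'; rewrite /sum_d1 mulr_sumr -big_split; apply: eq_bigr => i _ /=.
by rewrite cross_linear !mxE; ring.
Qed.

Lemma prior_d1_linear S : scalar (prior_d1 S).
Proof. by move=> a H H'; rewrite /prior_d1 sum_d1_linear; ring. Qed.

Lemma sum_d2_linear H : scalar (sum_d2 H).
Proof.
move=> a H1 H2; rewrite /sum_d2 mulrDr addrACA; congr (_ + _).
  rewrite mulr_sumr -big_split; apply: eq_bigr => i _ /=.
  by rewrite mulmxDl -scalemxAl mulmxDr -scalemxAr [fun_of_matrix (_ + _) _ _]mxE [fun_of_matrix (_ *: _) _ _]mxE; ring.
rewrite mulr_sumr -big_split; apply: eq_bigr => i _ /=.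
rewrite mulr_sumr -big_split; apply: eq_bigr => k _ /=.
by rewrite cross_linear !mxE; ring.
Qed.

Lemma prior_d2_linear S H : scalar (prior_d2 S H).
Proof. by move=> a H1 H2; rewrite /prior_d2 sum_d2_linear sum_d1_linear; ring. Qed.

HB.instance Definition _ S :=
  GRing.isLinear.Build R 'M[R]_(n, m) R *%R (prior_d1 S) (prior_d1_linear S).
HB.instance Definition _ S H :=
  GRing.isLinear.Build R 'M[R]_(n, m) R *%R (prior_d2 S H) (prior_d2_linear S H).

Lemma prior_d2C S H H' : prior_d2 S H H' = prior_d2 S H' H.
Proof.
rewrite /prior_d2 [X in _ + X]mulrAC; congr (_ * _ + _); congr (_ + _).
  apply: eq_bigr => i _; congr (_ * _); rewrite !mxE; apply: eq_bigr => k _.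
  by rewrite [(H *m U)^T _ _]mxE [(H' *m U)^T _ _]mxE mulrC.
by apply: eq_bigr => i _; apply: eq_bigr => k _; rewrite [_ * cross _ _ _]mulrC.
Qed.

Hypothesis UU : U^T *m U = 1%:M.
Hypothesis XX : X^T *m X = U *m diag_mx x *m U^T.

Lemma XU_gram i k : \sum_a (X *m U) a i * (X *m U) a k = x 0 i *+ (i == k).
Proof.
have : (X *m U)^T *m (X *m U) = diag_mx x.
  by rewrite trmx_mul -mulmxA (mulmxA X^T) XX !mulmxA UU mul1mx -mulmxA UU mulmx1.
move/(congr1 (fun M : 'M[R]_(m, m) => M i k)); rewrite [in RHS]mxE => <-.
by rewrite mxE; apply: eq_bigr => a _; rewrite [_^T i a]mxE.
Qed.

Lemma U_gram i k : \sum_b U b i * U b k = (i == k)%:R.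
Proof.
have /(congr1 (fun M : 'M[R]_(m, m) => M i k)) := UU; rewrite [in RHS]mxE => <-.
by rewrite mxE; apply: eq_bigr => a _; rewrite [_^T i a]mxE.
Qed.

Lemma delta_mulmx a b (a' : 'I_n) k :
  (delta_mx a b *m U) a' k = (a' == a)%:R * U b k.
Proof.
rewrite mxE (bigD1 b)//= big1 ?addr0 => [|j jb].
  by rewrite mxE eqxx andbT.
by rewrite mxE (negbTE jb) andbF mul0r.
Qed.

Lemma cross_delta a b i k : cross (delta_mx a b) i k =
  (X *m U) a i * U b k + U b i * (X *m U) a k.
Proof.
rewrite /cross [in LHS]mxE; congr (_ + _); rewrite mxE (bigD1 a)//= big1 ?addr0.
- by rewrite [_^T _ _]mxE delta_mulmx eqxx mul1r.
- by move=> a' /negbTE a'a; rewrite delta_mulmx a'a mul0r mulr0.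
- by rewrite [_^T _ _]mxE delta_mulmx eqxx mul1r.
- by move=> a' /negbTE a'a; rewrite [_^T _ _]mxE delta_mulmx a'a !mul0r.
Qed.

(** Half the Laplacian, computed in the basis of matrix units. The sums over that basis factor into
    Gram matrices: the columns of U are orthonormal, those of X U orthogonal with squared lengths
    x_i. *)
Lemma prior_d2_trace S : \sum_a \sum_b prior_d2 S (delta_mx a b) (delta_mx a b) =
  dpow (- c) S * (n%:R * (\sum_i dpow q (x 0 i + e)) +
    \sum_i \sum_k bpow q (x 0 i + e) (x 0 k + e) *
      (x 0 i + x 0 k + (2 * x 0 i) *+ (i == k)))
  + ddpow (- c) S / 2 * (4 * \sum_i dpow q (x 0 i + e) ^+ 2 * x 0 i).
Proof.
have sum2E (u : 'I_n -> 'I_m -> R) (v : 'I_n -> 'I_m -> R) :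
    \sum_a \sum_b (u a b + v a b) = \sum_a \sum_b u a b + \sum_a \sum_b v a b.
  by rewrite -big_split; apply: eq_bigr => a _; rewrite -big_split.
have sum2Z (k : R) (u : 'I_n -> 'I_m -> R) :
    \sum_a \sum_b k * u a b = k * \sum_a \sum_b u a b.
  by rewrite mulr_sumr; apply: eq_bigr => a _; rewrite mulr_sumr.
have sum2X (I : finType) (u : I -> 'I_n -> 'I_m -> R) :
    \sum_a \sum_b \sum_(i : I) u i a b = \sum_i \sum_a \sum_b u i a b.
  by under eq_bigr do rewrite exchange_big; rewrite exchange_big.
have prodE (u : 'I_n -> R) (v : 'I_m -> R) :
    \sum_a \sum_b u a * v b = (\sum_a u a) * (\sum_b v b).
  by rewrite mulr_suml; apply: eq_bigr => a _; rewrite mulr_sumr.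
pose Z := X *m U.
have crossE a b i k : cross (delta_mx a b) i k = Z a i * U b k + U b i * Z a k.
  exact: cross_delta.
have d1E a b : sum_d1 (delta_mx a b) = 2 * \sum_i dpow q (x 0 i + e) * (Z a i * U b i).
  rewrite /sum_d1 mulr_sumr; apply: eq_bigr => i _; rewrite crossE; ring.
have trd1 : \sum_a \sum_b sum_d1 (delta_mx a b) * sum_d1 (delta_mx a b) =
    4 * \sum_i dpow q (x 0 i + e) ^+ 2 * x 0 i.
  transitivity (\sum_a \sum_b \sum_i \sum_k 4 * dpow q (x 0 i + e) * dpow q (x 0 k + e) *
      ((Z a i * Z a k) * (U b i * U b k))).
    apply: eq_bigr => a _; apply: eq_bigr => b _; rewrite !d1E mulrACA mulr_suml mulr_sumr.
    apply: eq_bigr => i _; rewrite mulr_sumr mulr_sumr; apply: eq_bigr => k _; ring.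
  rewrite sum2X mulr_sumr; apply: eq_bigr => i _; rewrite sum2X (bigD1 i)//=.
  rewrite [X in _ + X]big1 ?addr0 => [|k ki].
    by rewrite sum2Z prodE XU_gram U_gram eqxx !mulr1n; ring.
  by rewrite sum2Z prodE U_gram eq_sym (negbTE ki) mulr0n; ring.
have trd2 : \sum_a \sum_b sum_d2 (delta_mx a b) (delta_mx a b) =
    n%:R * (\sum_i dpow q (x 0 i + e)) +
    \sum_i \sum_k bpow q (x 0 i + e) (x 0 k + e) *
      (x 0 i + x 0 k + (2 * x 0 i) *+ (i == k)).
  rewrite /sum_d2 sum2E; congr (_ + _).
    rewrite sum2X mulr_sumr; apply: eq_bigr => i _; rewrite sum2Z mulrC; congr (_ * _).
    transitivity (\sum_(a < n) \sum_b 1 * (U b i * U b i)).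
      apply: eq_bigr => a _; apply: eq_bigr => b _.
      rewrite mxE (bigD1 a)//= big1 ?addr0 => [|a' /negbTE a'a].
        by rewrite [_^T _ _]mxE delta_mulmx eqxx !mul1r.
      by rewrite delta_mulmx a'a mul0r mulr0.
    by rewrite prodE sumr_const card_ord U_gram eqxx mulr1.
  rewrite sum2X; apply: eq_bigr => i _; rewrite sum2X; apply: eq_bigr => k _.
  rewrite sum2Z; congr (_ * _).
  transitivity (\sum_a \sum_b ((Z a i * Z a i) * (U b k * U b k)
      + (Z a k * Z a k) * (U b i * U b i)
      + 2 * ((Z a i * Z a k) * (U b i * U b k)))).
    by apply: eq_bigr => a _; apply: eq_bigr => b _; rewrite crossE; ring.
  rewrite !sum2E sum2Z !prodE !XU_gram !U_gram !eqxx.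
  by case: eqVneq => [->|_]; rewrite ?mulr1n ?mulr0n; ring.
rewrite /prior_d2 sum2E sum2Z trd2; congr (_ + _).
rewrite -trd1 -sum2Z; apply: eq_bigr => a _; apply: eq_bigr => b _; ring.
Qed.

End TaylorForms.

(** * Uniform Taylor estimates for the regularized prior *)

(** Stands in for a C^3 function with nonpositive Laplacian. As B(H, H) is the whole second-order
    term, its trace is half the Laplacian. K depends on the ball only, while the forms depend on the
    point. *)
Definition superharmonic_jets (R : realType) n m (f : 'M[R]_(n, m) -> R) :=
  forall rho, exists2 K, 0 <= K & forall X, `|X| <= rho ->
  exists (l : {scalar 'M[R]_(n, m)}) (B : 'M[R]_(n, m) -> {scalar 'M[R]_(n, m)}),
  [/\ forall H H', B H H' = B H' H,
    \sum_a \sum_b B (delta_mx a b) (delta_mx a b) <= 0,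
    forall H, `|H| <= 1 -> `|l H| <= K * `|H|,
    forall H, `|H| <= 1 -> `|B H H| <= K * `|H| ^+ 2 &
    forall H, `|H| <= 1 -> `|f (X + H) - (f X + l H + B H H)| <= K * `|H| ^+ 3].

Section SmoothPrior.
Context {R : realType} {n m : nat}.
Variables (q e c : R).

Definition smooth_sum (X : 'M[R]_(n, m)) := spectral_sum (fun x => (x + e) `^ q) X.
Definition smooth_prior (X : 'M[R]_(n, m)) := smooth_sum X `^ (- c).

Hypothesis m_gt0 : (0 < m)%N.
Hypothesis q0 : 0 < q.
Hypothesis q1 : q <= 1.
Hypothesis e0 : 0 < e.
Hypothesis c0 : 0 <= c.

Lemma smooth_sum_ge (X : 'M[R]_(n, m)) : e `^ q <= smooth_sum X.
Proof.
have h (i : 'I_m) : e `^ q <= (tnth (singular_values X) i ^+ 2 + e) `^ q.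
  by apply: ge0_ler_powR; rewrite ?nnegrE ?lerDr ?addr_ge0 ?sqr_ge0// ltW.
rewrite /smooth_sum /spectral_sum (bigD1 (Ordinal m_gt0))//= -[leLHS]addr0.
by apply: lerD => //; apply: sumr_ge0 => i _; exact: powR_ge0.
Qed.

Lemma smooth_sum_gt0 (X : 'M[R]_(n, m)) : 0 < smooth_sum X.
Proof. by apply: lt_le_trans (smooth_sum_ge X); rewrite powR_gt0. Qed.

(** With the factor c S^(-c-2) taken out, the trace is the difference of the two sides of
    [laplacian_sign]. *)
Lemma prior_d2_trace_le0 (X : 'M[R]_(n, m)) (U : 'M[R]_m) (x : 'rV[R]_m) :
    (m <= n)%N -> admissible n m q c ->
    U^T *m U = 1%:M -> X^T *m X = U *m diag_mx x *m U^T -> (forall i, 0 <= x 0 i) ->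
  \sum_a \sum_b prior_d2 q e c X U x (smooth_sum X) (delta_mx a b) (delta_mx a b) <= 0.
Proof.
move=> mn adm UU XX x0; rewrite (prior_d2_trace q e c UU XX).
have S0 := smooth_sum_gt0 X.
have SE : smooth_sum X = \sum_i (x 0 i + e) `^ q by exact: spectral_sumE UU XX.
have main := @laplacian_sign _ n m q c (fun i => x 0 i + e) (fun i => x 0 i)
  mn q0 q1 c0 adm.
have a0 i : 0 < x 0 i + e by rewrite ltr_wpDl.
have xa i : 0 <= x 0 i <= x 0 i + e by rewrite x0 lerDl ltW.
have {main} := main a0 xa; rewrite -SE.
set A := \sum_i dpow q _ ^+ 2 * _; set B := n%:R * _ + _; set S := smooth_sum X in S0 *.
rewrite /dpow /ddpow => main.
rewrite (_ : - c - 1 = (- c - 2) + 1); last by ring.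
rewrite powRS//.
rewrite [leLHS](_ : _ = c * S `^ (- c - 2) * (2 * (c + 1) * A - S * B)); last by field.
by rewrite mulr_ge0_le0 ?subr_le0// mulr_ge0// powR_ge0.
Qed.

Section Perturbations.
Variable rho : R.

(** The index type for [of_order]. Eigenbases of both Gram matrices are carried as data, so that
    estimates are uniform over all choices and none has to depend continuously on the matrix. *)
Record perturbation := Perturbation {
  pX : 'M[R]_(n, m); pH : 'M[R]_(n, m);
  pU : 'M[R]_m; pW : 'M[R]_m; px : 'rV[R]_m; py : 'rV[R]_m;
  pX_le : `|pX| <= rho; pH_le : `|pH| <= 1;
  pUU : pU^T *m pU = 1%:M;
  pXX : pX^T *m pX = pU *m diag_mx px *m pU^T;
  px0 : forall i, 0 <= px 0 i;
  pWW : pW^T *m pW = 1%:M;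
  pYY : (pX + pH)^T *m (pX + pH) = pW *m diag_mx py *m pW^T;
  py0 : forall i, 0 <= py 0 i }.

Definition psize z := `|pH z|.

Lemma psize01 z : 0 <= psize z <= 1.
Proof. by rewrite normr_ge0 pH_le. Qed.

Notation O := (of_order psize).

Lemma orderXU i k : O 0 (fun z => (pX z *m pU z) i k).
Proof.
apply: (@of_order_eq _ _ _ _ (fun z => \sum_j pX z i j * pU z j k)).
  by move=> z; rewrite mxE.
apply: of_order_sum => j; apply: (@of_orderM _ _ _ 0 0).
  apply: (@of_order0 _ _ _ _ rho) => z.
  exact: le_trans (mx_entry_le _ _ _) (pX_le z).
apply: (@of_order0 _ _ _ _ 1) => z; apply: orthogonal_le1.
exact/mulmx1C/pUU.
Qed.

Lemma orderHU i k : O 1 (fun z => (pH z *m pU z) i k).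
Proof.
apply: (@of_order_eq _ _ _ _ (fun z => \sum_j pH z i j * pU z j k)).
  by move=> z; rewrite mxE.
apply: of_order_sum => j; apply: (@of_orderM _ _ _ 1 0).
  exists 1 => // z; rewrite mul1r; exact: mx_entry_le.
apply: (@of_order0 _ _ _ _ 1) => z; apply: orthogonal_le1.
exact/mulmx1C/pUU.
Qed.

Lemma order_cross i k : O 1 (fun z => cross (pX z) (pU z) (pH z) i k).
Proof.
apply: (@of_order_eq _ _ _ _ (fun z =>
    \sum_j (pX z *m pU z) j i * (pH z *m pU z) j k +
    \sum_j (pH z *m pU z) j i * (pX z *m pU z) j k)).
  move=> z; rewrite /cross [RHS]mxE; congr (_ + _); rewrite mxE;
    by apply: eq_bigr => j _; rewrite [_^T _ _]mxE.
apply: of_orderD; apply: of_order_sum => j.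
  by apply: (@of_orderM _ _ _ 0 1); [exact: orderXU|exact: orderHU].
by apply: (@of_orderM _ _ _ 1 0); [exact: orderHU|exact: orderXU].
Qed.

Lemma order_square i k : O 2 (fun z => ((pH z *m pU z)^T *m (pH z *m pU z)) i k).
Proof.
apply: (@of_order_eq _ _ _ _ (fun z =>
    \sum_j (pH z *m pU z) j i * (pH z *m pU z) j k)).
  by move=> z; rewrite [RHS]mxE; apply: eq_bigr => j _; rewrite [_^T _ _]mxE.
apply: of_order_sum => j.
by apply: (@of_orderM _ _ _ 1 1); exact: orderHU.
Qed.

Lemma order_dpow i : O 0 (fun z => dpow q (px z 0 i + e)).
Proof.
have [L _ [dL _ _]] := bpow_bounds q1 e0.
by apply: (@of_order0 _ _ _ _ L) => z; apply: dL; rewrite lerDr px0.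
Qed.

Lemma order_bpow i k : O 0 (fun z => bpow q (px z 0 i + e) (px z 0 k + e)).
Proof.
have [L _ [_ bL _]] := bpow_bounds q1 e0.
by apply: (@of_order0 _ _ _ _ L) => z; apply: bL; rewrite lerDr px0.
Qed.

Lemma order_sum_d1 : O 1 (fun z => sum_d1 q e (pX z) (pU z) (px z) (pH z)).
Proof.
apply: of_order_sum => i; apply: (@of_orderM _ _ _ 0 1); first exact: order_dpow.
exact: order_cross.
Qed.

Lemma order_sum_d2 : O 2 (fun z => sum_d2 q e (pX z) (pU z) (px z) (pH z) (pH z)).
Proof.
apply: of_orderD; apply: of_order_sum => i.
  apply: (@of_orderM _ _ _ 0 2); first exact: order_dpow.
  exact: order_square.
apply: of_order_sum => k; apply: (@of_orderM _ _ _ 0 2); first exact: order_bpow.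
by apply: (@of_orderM _ _ _ 1 1); exact: order_cross.
Qed.

(** In the eigenbasis the Gram matrix changes by C + D, of orders 1 and 2. The error of
    [spectral_sum_expansion] is cubic in this change; in the quadratic term only the squares of C
    are kept, and the products containing D have order at least 3. *)
Lemma order_sum_remainder : O 3 (fun z => smooth_sum (pX z + pH z) -
  (smooth_sum (pX z) + sum_d1 q e (pX z) (pU z) (px z) (pH z) +
   sum_d2 q e (pX z) (pU z) (px z) (pH z) (pH z))).
Proof.
have [L L0 [_ _ bL]] := bpow_bounds q1 e0.
pose C z := cross (pX z) (pU z) (pH z).
pose D z := (pH z *m pU z)^T *m (pH z *m pU z).
have FE z : (pU z)^T *m ((pX z + pH z)^T *m (pX z + pH z) - (pX z)^T *m pX z) *m pU z
    = C z + D z.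
  have -> : (pX z + pH z)^T *m (pX z + pH z) - (pX z)^T *m pX z =
      (pX z)^T *m pH z + (pH z)^T *m pX z + (pH z)^T *m pH z.
    rewrite [(_ + _)^T]linearD /= mulmxDl !mulmxDr.
    by rewrite addrC -!addrA addKr.
  by rewrite /C /D /cross !trmx_mul !mulmxDr !mulmxDl !mulmxA.
have orderF i k : O 1 (fun z => (C z + D z) i k).
  apply: (@of_order_eq _ _ _ _ (fun z => C z i k + D z i k)).
    by move=> z; rewrite [RHS]mxE.
  apply: of_orderD; first exact: order_cross.
  by apply: (of_orderW psize01 (isT : 1 <= 2)%N); exact: order_square.
pose N z : R := \sum_i \sum_k `|(C z + D z) i k|.
have orderN : O 1 N.
  by apply: of_order_sum => i; apply: of_order_sum => k; apply: of_order_norm.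
pose d1 z i : R := dpow q (px z 0 i + e).
pose b2 z i k : R := bpow q (px z 0 i + e) (px z 0 k + e).
pose main z : R := smooth_sum (pX z) + \sum_i d1 z i * (C z + D z) i i
     + \sum_i \sum_k b2 z i k * (C z + D z) i k ^+ 2.
have order_main : O 3 (fun z => smooth_sum (pX z + pH z) - main z).
  apply: (@of_order_le _ _ _ _ _ (fun z => m%:R ^+ 4 * L * (N z * (N z * N z)))).
    move=> z; have := @spectral_sum_expansion _ (fun x => (x + e) `^ q)
      (fun x => dpow q (x + e)) (fun x y => bpow q (x + e) (y + e)) L L0 _ _ n m
      (pX z) (pX z + pH z) (pU z) (pW z) (px z) (py z) (pUU z) (pXX z) (px0 z)
      (pWW z) (pYY z) (py0 z).
    rewrite FE (_ : N z * (N z * N z) = N z ^+ 3); last by ring.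
    apply.
      move=> x y _ _; rewrite [LHS](bpowE q (x + e) (y + e)).
      by rewrite (_ : y + e - (x + e) = y - x)//; ring.
    move=> x y y' x_ge0 y_ge0 y'_ge0.
    have := bL (x + e) (y + e) (y' + e); rewrite !lerDr => /(_ x_ge0 y_ge0 y'_ge0).
    by rewrite (_ : y + e - (y' + e) = y - y')//; ring.
  apply: (@of_orderM _ _ _ 0 3).
    by apply: (@of_order0 _ _ _ _ `|m%:R ^+ 4 * L|).
  by apply: (@of_orderM _ _ _ 1 2) => //; apply: (@of_orderM _ _ _ 1 1).
apply: (@of_order_eq _ _ _ _ (fun z => (smooth_sum (pX z + pH z) - main z) +
    \sum_i \sum_k b2 z i k * (2 * (C z i k * D z i k) + D z i k * D z i k))).
  move=> z; rewrite /main /sum_d1 /sum_d2 -/(C z).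
  have -> : \sum_i d1 z i * (C z + D z) i i =
      \sum_i d1 z i * C z i i + \sum_i d1 z i * D z i i.
    by rewrite -big_split; apply: eq_bigr => i _ /=; rewrite mxE mulrDr.
  have -> : \sum_i \sum_k b2 z i k * (C z + D z) i k ^+ 2 =
      \sum_i \sum_k b2 z i k * (C z i k * C z i k) +
      \sum_i \sum_k b2 z i k * (2 * (C z i k * D z i k) + D z i k * D z i k).
    rewrite -big_split; apply: eq_bigr => i _ /=.
    by rewrite -big_split; apply: eq_bigr => k _ /=; rewrite mxE; ring.
  have ac (s' s a1 a2 a3 a4 : R) :
    s' - (s + (a1 + a2) + (a3 + a4)) + a4 = s' - (s + a1 + (a2 + a3)) by ring.
  exact: ac.
apply: of_orderD => //; apply: of_order_sum => i; apply: of_order_sum => k.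
apply: (@of_orderM _ _ _ 0 3); first exact: order_bpow.
apply: of_orderD.
  apply: (@of_orderM _ _ _ 0 3); first exact: (@of_order0 _ _ _ _ `|2|).
  by apply: (@of_orderM _ _ _ 1 2); [exact: order_cross|exact: order_square].
apply: (of_orderW psize01 (isT : 3 <= 4)%N).
by apply: (@of_orderM _ _ _ 2 2); exact: order_square.
Qed.

Lemma order_dpow_sum : O 0 (fun z => dpow (- c) (smooth_sum (pX z))).
Proof.
have c1 : - c <= 1 by rewrite (le_trans _ ler01)// oppr_le0.
have [L _ [dL _ _]] := bpow_bounds c1 (powR_gt0 q e0).
by apply: (@of_order0 _ _ _ _ L) => z; apply: dL; exact: smooth_sum_ge.
Qed.

Lemma order_ddpow_sum : O 0 (fun z => ddpow (- c) (smooth_sum (pX z)) / 2).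
Proof.
have c1 : - c <= 1 by rewrite (le_trans _ ler01)// oppr_le0.
have [L _ [_ bL _]] := bpow_bounds c1 (powR_gt0 q e0).
apply: (@of_order0 _ _ _ _ L) => z.
have := bL _ _ (smooth_sum_ge (pX z)) (smooth_sum_ge (pX z)).
by rewrite /bpow /bregman eqxx.
Qed.

Definition d1_at z := prior_d1 q e c (pX z) (pU z) (px z) (smooth_sum (pX z)).
Definition d2_at z := prior_d2 q e c (pX z) (pU z) (px z) (smooth_sum (pX z)).

Lemma order_prior_d1 : O 1 (fun z => d1_at z (pH z)).
Proof.
by apply: (@of_orderM _ _ _ 0 1); [exact: order_dpow_sum|exact: order_sum_d1].
Qed.

Lemma order_prior_d2 : O 2 (fun z => d2_at z (pH z) (pH z)).
Proof.
apply: of_orderD.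
  apply: (@of_orderM _ _ _ 0 2); first exact: order_dpow_sum.
  exact: order_sum_d2.
apply: (@of_orderM _ _ _ 1 1); last exact: order_sum_d1.
by apply: (@of_orderM _ _ _ 0 1); [exact: order_ddpow_sum|exact: order_sum_d1].
Qed.

(** The outer power is expanded at S by [bpowE]. Moving its quadratic weight to the diagonal costs
    O(|S' - S|), which multiplies (S' - S)^2; and (S' - S)^2 differs from the square of the linear
    part by terms of order 3. *)
Lemma order_prior_remainder : O 3 (fun z => smooth_prior (pX z + pH z) -
  (smooth_prior (pX z) + d1_at z (pH z) + d2_at z (pH z) (pH z))).
Proof.
have c1 : - c <= 1 by rewrite (le_trans _ ler01)// oppr_le0.
have [L L0 [_ _ bL]] := bpow_bounds c1 (powR_gt0 q e0).
pose S z := smooth_sum (pX z); pose S' z := smooth_sum (pX z + pH z).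
pose l z := sum_d1 q e (pX z) (pU z) (px z) (pH z).
pose b z := sum_d2 q e (pX z) (pU z) (px z) (pH z) (pH z).
pose r z := S' z - (S z + l z + b z).
have Or : O 3 r := order_sum_remainder.
have Ol : O 1 l := order_sum_d1.
have Ob : O 2 b := order_sum_d2.
have Obr : O 2 (fun z => b z + r z).
  by apply: of_orderD => //; exact: (of_orderW psize01 (isT : 2 <= 3)%N).
have OS : O 1 (fun z => S' z - S z).
  apply: (@of_order_eq _ _ _ _ (fun z => l z + (b z + r z))).
    by move=> z; rewrite /r; ring.
  by apply: of_orderD => //; exact: (of_orderW psize01 (isT : 1 <= 2)%N).
pose B z := bpow (- c) (S z) (S' z) - ddpow (- c) (S z) / 2.
have OB : O 1 B.
  apply: (@of_order_le _ _ _ _ _ (fun z => L * `|S' z - S z|)).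
    move=> z; have := bL _ _ _ (smooth_sum_ge (pX z)) (smooth_sum_ge (pX z + pH z))
      (smooth_sum_ge (pX z)).
    by rewrite {2}/bpow /bregman eqxx.
  apply: (@of_orderM _ _ _ 0 1); first exact: (@of_order0 _ _ _ _ `|L|).
  exact: of_order_norm.
apply: (@of_order_eq _ _ _ _ (fun z => dpow (- c) (S z) * r z +
   (ddpow (- c) (S z) / 2 * (2 * (l z * (b z + r z)) + (b z + r z) * (b z + r z)) +
    B z * ((S' z - S z) * (S' z - S z))))).
  have ac (f' f d dd bp s s' l' b' : R) (r' := s' - (s + l' + b')) :
      f' = f + d * (s' - s) + bp * (s' - s) ^+ 2 ->
    d * r' + (dd * (2 * (l' * (b' + r')) + (b' + r') * (b' + r')) +
      (bp - dd) * ((s' - s) * (s' - s))) =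
    f' - (f + d * l' + (d * b' + dd * l' * l')).
    by move=> ->; rewrite /r'; ring.
  by move=> z; apply: ac; exact: bpowE.
apply: of_orderD.
  by apply: (@of_orderM _ _ _ 0 3); first exact: order_dpow_sum.
apply: of_orderD.
  apply: (@of_orderM _ _ _ 0 3); first exact: order_ddpow_sum.
  apply: of_orderD.
    apply: (@of_orderM _ _ _ 0 3); first exact: (@of_order0 _ _ _ _ `|2|).
    exact: (@of_orderM _ _ _ 1 2).
  apply: (of_orderW psize01 (isT : 3 <= 4)%N).
  exact: (@of_orderM _ _ _ 2 2).
by apply: (@of_orderM _ _ _ 1 2) => //; exact: (@of_orderM _ _ _ 1 1).
Qed.

End Perturbations.

Lemma smooth_prior_jets : (m <= n)%N -> admissible n m q c ->
  superharmonic_jets smooth_prior.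
Proof.
move=> mn adm rho.
have [K0 K00 hK0] := order_prior_d1 rho.
have [K1 K10 hK1] := order_prior_d2 rho.
have [K2 K20 hK2] := order_prior_remainder rho.
exists (K0 + K1 + K2) => [|X Xr]; first by rewrite !addr_ge0.
have [U [x [UU XX x0]]] := spectral_decomposition X.
exists (prior_d1 q e c X U x (smooth_sum X)), (prior_d2 q e c X U x (smooth_sum X)).
(* U and x are fixed by X before H is given, so the forms do not depend on H; only the eigenbasis of
   X + H varies. *)
have datum H : `|H| <= 1 -> exists z : perturbation rho,
    [/\ pX z = X, pH z = H, pU z = U & px z = x].
  move=> H1; have [W [y [WW YY y0]]] := spectral_decomposition (X + H).
  by exists (Perturbation Xr H1 UU XX x0 WW YY y0).
split.
- by move=> H H'; exact: prior_d2C.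
- exact: prior_d2_trace_le0.
- move=> H /datum[z [zX zH zU zx]].
  have := hK0 z; rewrite /d1_at /psize zX zH zU zx => /le_trans; apply.
  by rewrite ler_wpM2r// -addrA lerDl addr_ge0.
- move=> H /datum[z [zX zH zU zx]].
  have := hK1 z; rewrite /d2_at /psize zX zH zU zx => /le_trans; apply.
  by rewrite ler_wpM2r ?exprn_ge0// addrAC lerDr addr_ge0.
- move=> H /datum[z [zX zH zU zx]].
  have := hK2 z; rewrite /d1_at /d2_at /psize zX zH zU zx => /le_trans; apply.
  by rewrite ler_wpM2r ?exprn_ge0// lerDr addr_ge0.
Qed.

End SmoothPrior.

(** * Plane rotations of the space of matrices *)

Section SumNeq.
Context {R : realType}.

Lemma sum_neq_sym (I : finType) (u : I -> R) :
  \sum_k \sum_(l | l != k) (u k + u l) = 2 * (#|I|%:R - 1) * \sum_k u k.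
Proof.
transitivity (\sum_k ((#|I|%:R - 2) * u k + \sum_l u l)).
  apply: eq_bigr => k _; rewrite sum_neq big_split /= sumr_const cardT -cardE; ring.
by rewrite big_split /= -mulr_sumr sumr_const cardT -cardE; ring.
Qed.

End SumNeq.

Section Rotations.
Context {R : realType} {n m : nat}.
Implicit Types (X H : 'M[R]_(n, m)) (k l : 'I_n * 'I_m).

Definition mx_coord X k : R := X k.1 k.2.
Definition unit_mx k : 'M[R]_(n, m) := delta_mx k.1 k.2.
(** The projection of X onto a coordinate plane, followed by the same projection after a quarter
    turn: the infinitesimal rotation of that plane applied to X. *)
Definition plane_part k l X := mx_coord X k *: unit_mx k + mx_coord X l *: unit_mx l.
Definition plane_turn k l X := mx_coord X k *: unit_mx l - mx_coord X l *: unit_mx k.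

(* The rotation of cosine [1 + a] and sine [s] in the plane of the entries [k]
   and [l]. *)
Definition rotation k l (a s : R) X := X + a *: plane_part k l X + s *: plane_turn k l X.

Lemma plane_part_linear k l : linear (plane_part k l).
Proof.
move=> a X H; rewrite /plane_part /mx_coord !mxE !scalerDl !scalerDr !scalerA.
by rewrite addrACA.
Qed.

Lemma plane_turn_linear k l : linear (plane_turn k l).
Proof.
move=> a X H; rewrite /plane_turn /mx_coord !mxE !scalerDl !scalerBr !scalerA.
by rewrite opprD addrACA.
Qed.

Lemma rotation_linear k l a s : linear (rotation k l a s).
Proof.
move=> b X H; rewrite /rotation plane_part_linear plane_turn_linear.
move: (plane_part k l X) (plane_part k l H) (plane_turn k l X) (plane_turn k l H).
by move=> p p' u u'; apply/matrixP => i j; rewrite !mxE; ring.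
Qed.

HB.instance Definition _ k l a s :=
  GRing.isLinear.Build R 'M[R]_(n, m) 'M[R]_(n, m) *:%R (rotation k l a s)
    (rotation_linear k l a s).

Lemma sum_mx_coord X : X = \sum_k mx_coord X k *: unit_mx k.
Proof.
rewrite [LHS]matrix_sum_delta pair_big /=.
by apply: eq_bigr => -[i j].
Qed.

Lemma unit_mxE k l : mx_coord (unit_mx k) l = (l == k)%:R.
Proof. by case: k l => [a b] [a' b']; rewrite /mx_coord /unit_mx mxE -xpair_eqE. Qed.

Definition sqnorm X := \sum_k mx_coord X k ^+ 2.

Lemma sqnormE X : \sum_i \sum_j X i j ^+ 2 = sqnorm X.
Proof. by rewrite pair_big /=; apply: eq_bigr => -[]. Qed.

Lemma rotation_sqnorm k l a s X : k != l -> (1 + a) ^+ 2 + s ^+ 2 = 1 ->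
  sqnorm (rotation k l a s X) = sqnorm X.
Proof.
move=> kl as1; have lk : l != k by rewrite eq_sym.
have cE i : mx_coord (rotation k l a s X) i = mx_coord X i
    + (a * mx_coord X k - s * mx_coord X l) * (i == k)%:R
    + (a * mx_coord X l + s * mx_coord X k) * (i == l)%:R.
  rewrite -!unit_mxE /rotation /plane_part /plane_turn /mx_coord !mxE; ring.
rewrite /sqnorm (bigD1 k)//= (bigD1 l)//= [RHS](bigD1 k)//= [X in _ = _ + X](bigD1 l)//=.
rewrite !addrA; congr (_ + _); last first.
  apply: eq_bigr => i /andP[/negbTE ik /negbTE il].
  by rewrite cE ik il !mulr0 !addr0.
rewrite !cE !eqxx (negbTE kl) (negbTE lk) !mulr1 !mulr0 !addr0.
have := as1; set x := mx_coord X k; set y := mx_coord X l => E.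
rewrite -[RHS]mul1r -E; ring.
Qed.

Lemma norm_coord_le X k : `|mx_coord X k| <= `|X|.
Proof. exact: mx_entry_le. Qed.

Lemma norm_unit_mx k : `|unit_mx k| <= 1.
Proof.
rewrite [leLHS]/Num.norm /= mx_normrE; apply: bigmax_le => // -[i j] _ /=.
have -> : unit_mx k i j = ((i, j) == k)%:R by rewrite -unit_mxE.
by case: (_ == _); rewrite ?normr1 ?normr0.
Qed.

Lemma norm_plane_part k l X : `|plane_part k l X| <= 2 * `|X|.
Proof.
have h i j : `|mx_coord X i *: unit_mx j| <= `|X|.
  rewrite normrZ -[leRHS]mulr1; apply: ler_pM => //; first exact: norm_coord_le.
  exact: norm_unit_mx.
by apply: le_trans (ler_normD _ _) _; rewrite mulr_natl mulr2n lerD.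
Qed.

Lemma norm_plane_turn k l X : `|plane_turn k l X| <= 2 * `|X|.
Proof.
have h i j : `|mx_coord X i *: unit_mx j| <= `|X|.
  rewrite normrZ -[leRHS]mulr1; apply: ler_pM => //; first exact: norm_coord_le.
  exact: norm_unit_mx.
by apply: le_trans (ler_normB _ _) _; rewrite mulr_natl mulr2n lerD.
Qed.

(** Lagrange's identity for quadratic forms. Tangential directions account for the full trace minus
    the radial value B(X, X); the factor 2 is due to ordered pairs, and the terms k = l vanish. *)
Lemma sum_plane_turn (B : 'M[R]_(n, m) -> {scalar 'M[R]_(n, m)}) X :
    (forall H H', B H H' = B H' H) ->
  \sum_k \sum_(l | l != k) B (plane_turn k l X) (plane_turn k l X) =
  2 * sqnorm X * (\sum_k B (unit_mx k) (unit_mx k)) - 2 * B X X.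
Proof.
move=> BC; pose x := mx_coord X; pose b k l := B (unit_mx k) (unit_mx l).
have Bsub w u v : B w (u - v) = B w u - B w v by exact: linearB.
have BZ w a u : B w (a *: u) = a * B w u by exact: linearZ.
have BE k l : B (plane_turn k l X) (plane_turn k l X) =
    x k ^+ 2 * b l l + x l ^+ 2 * b k k - 2 * (x k * x l * b k l).
  rewrite /plane_turn Bsub !BZ !(BC (_ - _)) !Bsub !BZ.
  rewrite (BC (unit_mx l) (unit_mx k)) /b /x; ring.
have BXX : B X X = \sum_k \sum_l x k * x l * b k l.
  rewrite [X in B X _]sum_mx_coord BC linear_sum; apply: eq_bigr => k _ /=.
  rewrite BZ BC [X in B _ X]sum_mx_coord linear_sum mulr_sumr.
  by apply: eq_bigr => l _ /=; rewrite BZ mulrA.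
transitivity (\sum_k \sum_l (x k ^+ 2 * b l l + x l ^+ 2 * b k k - 2 * (x k * x l * b k l))).
  apply: eq_bigr => k _; rewrite [in RHS](bigD1 k)//= [X in _ = X + _](_ : _ = 0).
    by rewrite add0r; apply: eq_bigr => l _; rewrite BE.
  ring.
rewrite BXX.
transitivity (\sum_k \sum_l x k ^+ 2 * b l l + \sum_k \sum_l x l ^+ 2 * b k k
    - \sum_k \sum_l 2 * (x k * x l * b k l)).
  rewrite -big_split -sumrB; apply: eq_bigr => k _ /=.
  by rewrite -big_split -sumrB.
have E : \sum_k \sum_l x k ^+ 2 * b l l = sqnorm X * \sum_k b k k.
  by rewrite /sqnorm mulr_suml; apply: eq_bigr => k _; rewrite mulr_sumr.
rewrite [X in _ + X - _]exchange_big /= E; congr (_ - _); first by rewrite /b; ring.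
by rewrite mulr_sumr; apply: eq_bigr => k _; rewrite mulr_sumr.
Qed.

End Rotations.

(** * Second differences along rotations and along the radius *)

Section SecondDifferences.
Context {R : realType} {n m : nat}.
Local Notation M := 'M[R]_(n, m).
Implicit Types (f : M -> R) (l : {scalar M}) (B : M -> {scalar M}).

(** Adding the increments for s and -s cancels every term odd in A, including the mixed one B(A,
    P). *)
Lemma jet_pair f Y l B K (P A : M) a s h :
    0 <= K -> (forall H H', B H H' = B H' H) ->
    (forall H, `|H| <= 1 -> `|f (Y + H) - (f Y + l H + B H H)| <= K * `|H| ^+ 3) ->
    `|a *: P + s *: A| <= h -> `|a *: P + (- s) *: A| <= h -> h <= 1 ->
  f (Y + (a *: P + s *: A)) + f (Y + (a *: P + (- s) *: A)) - 2 * f Y <=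
  2 * a * l P + 2 * B (a *: P) (a *: P) + 2 * s ^+ 2 * B A A + 2 * (K * h ^+ 3).
Proof.
move=> K0 BC fT h1 h2 hle1.
have ub H : `|H| <= h -> f (Y + H) <= f Y + l H + B H H + K * h ^+ 3.
  move=> Hh; have /ler_normlP[_] := fT H (le_trans Hh hle1).
  have : K * `|H| ^+ 3 <= K * h ^+ 3.
    by rewrite ler_wpM2l// lerXn2r ?nnegrE// (le_trans _ Hh).
  lra.
have BD w u v : B w (u + v) = B w u + B w v by exact: linearD.
have BZ w b u : B w (b *: u) = b * B w u by exact: linearZ.
have lE s' : l (a *: P + s' *: A) = a * l P + s' * l A by rewrite linearP linearZ.
have BE s' : B (a *: P + s' *: A) (a *: P + s' *: A) =
    B (a *: P) (a *: P) + s' ^+ 2 * B A A + 2 * s' * a * B A P.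
  rewrite !(BD, BZ) !(BC (_ + _)) !(BD, BZ) !(BC (_ *: _)) !(BD, BZ) (BC P A).
  ring.
have := ub _ h1; have := ub _ h2; rewrite !lE !BE; lra.
Qed.

Variables (f : M -> R) (Y X : M) (l : {scalar M}) (B : M -> {scalar M}) (K r t : R).
Hypothesis K0 : 0 <= K.
Hypothesis BC : forall H H', B H H' = B H' H.
Hypothesis B_le : forall H, `|H| <= 1 -> `|B H H| <= K * `|H| ^+ 2.
Hypothesis fT : forall H, `|H| <= 1 ->
  `|f (Y + H) - (f Y + l H + B H H)| <= K * `|H| ^+ 3.
Hypothesis Xr : `|X| <= r.
Hypothesis t0 : 0 < t.
Hypothesis t1 : t <= 1.

Let r0 : 0 <= r. Proof. exact: le_trans Xr. Qed.

(** The cosine is taken to be 1 - t^2/2, which forces s^2 = t^2 - t^4/4 and keeps everything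
    algebraic in t. The term linear in l is the inward bending of the circle; replacing s^2 by t^2
    costs only order t^4. *)
Lemma jet_rotation_pair k j s : 0 <= s -> s ^+ 2 = t ^+ 2 - t ^+ 4 / 4 -> 3 * r * t <= 1 ->
  f (Y + ((- (t ^+ 2 / 2)) *: plane_part k j X + s *: plane_turn k j X)) +
  f (Y + ((- (t ^+ 2 / 2)) *: plane_part k j X + (- s) *: plane_turn k j X)) - 2 * f Y <=
  - t ^+ 2 * l (plane_part k j X)
  + 2 * t ^+ 2 * B (plane_turn k j X) (plane_turn k j X)
  + (4 * K * r ^+ 2 + 2 * K * (3 * r) ^+ 3) * t ^+ 3.
Proof.
move=> s0 s2 rt; set P := plane_part k j X; set A := plane_turn k j X.
have tt : 0 <= t ^+ 2 by exact: sqr_ge0.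
have t21 : t ^+ 2 <= t by rewrite expr2 ler_piMr// ltW.
have t43 : t ^+ 4 <= t ^+ 3 by rewrite [leLHS]exprS ler_piMl// exprn_ge0// ltW.
have t4 : 0 <= t ^+ 4 by rewrite exprn_ge0// ltW.
have st : s <= t.
  rewrite -(@ler_pXn2r _ 2) ?nnegrE ?(ltW t0)//; lra.
have Pr : `|P| <= 2 * r.
  by apply: le_trans (norm_plane_part _ _ _) _; rewrite ler_wpM2l.
have Ar : `|A| <= 2 * r.
  by apply: le_trans (norm_plane_turn _ _ _) _; rewrite ler_wpM2l.
have aP : `|(- (t ^+ 2 / 2)) *: P| <= r * t ^+ 2.
  rewrite normrZ normrN ger0_norm ?divr_ge0//.
  rewrite (_ : r * t ^+ 2 = t ^+ 2 / 2 * (2 * r)); last by field.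
  by rewrite ler_wpM2l ?divr_ge0.
have sA s' : `|s'| = s -> `|s' *: A| <= 2 * r * t.
  move=> E; rewrite normrZ E mulrC; apply: ler_pM => //.
have tA : `|t ^+ 2 *: A| <= 2 * r * t ^+ 2.
  by rewrite normrZ ger0_norm// mulrC ler_wpM2r.
have rt2 : r * t ^+ 2 <= r * t by rewrite ler_wpM2l.
have rt0 : 0 <= r * t by rewrite mulr_ge0// ltW.
have pair : f (Y + ((- (t ^+ 2 / 2)) *: P + s *: A)) +
  f (Y + ((- (t ^+ 2 / 2)) *: P + (- s) *: A)) - 2 * f Y <= _ :=
  @jet_pair f Y l B K P A (- (t ^+ 2 / 2)) s (3 * r * t) K0 BC fT _ _ rt.
apply: (le_trans (pair _ _)).
- apply: le_trans (ler_normD _ _) _; have := sA s (ger0_norm s0); lra.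
- apply: le_trans (ler_normD _ _) _.
  have := sA (- s); rewrite normrN ger0_norm// => /(_ erefl); lra.
have B1 : B ((- (t ^+ 2 / 2)) *: P) ((- (t ^+ 2 / 2)) *: P) <= K * r ^+ 2 * t ^+ 3.
  apply: le_trans (ler_norm _) _; apply: le_trans (B_le _) _; first lra.
  rewrite -mulrA ler_wpM2l//; apply: (@le_trans _ _ ((r * t ^+ 2) ^+ 2)).
    by rewrite lerXn2r ?nnegrE// mulr_ge0.
  by rewrite exprMn -exprM ler_wpM2l ?sqr_ge0.
have B2 : - (t ^+ 4 * B A A) <= 4 * (K * r ^+ 2 * t ^+ 3).
  have -> : - (t ^+ 4 * B A A) = - B (t ^+ 2 *: A) (t ^+ 2 *: A).
    have BZ w b u : B w (b *: u) = b * B w u by exact: linearZ.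
    by rewrite BZ (BC (_ *: _)) BZ; ring.
  apply: le_trans (ler_norm _) _; rewrite normrN; apply: le_trans (B_le _) _.
    by apply: le_trans tA _; lra.
  rewrite [leRHS](_ : _ = K * ((2 * r) ^+ 2 * t ^+ 3)); last by ring.
  rewrite ler_wpM2l//; apply: (@le_trans _ _ ((2 * r * t ^+ 2) ^+ 2)).
    by rewrite lerXn2r ?nnegrE// mulr_ge0// mulr_ge0.
  by rewrite exprMn -exprM ler_wpM2l ?sqr_ge0.
rewrite s2; lra.
Qed.

Lemma jet_radial_pair c : 0 <= c -> (c + 1) * r * t <= 1 ->
  f (Y + ((c * t ^+ 2) *: X + t *: X)) +
  f (Y + ((c * t ^+ 2) *: X + (- t) *: X)) - 2 * f Y <=
  2 * c * t ^+ 2 * l X + 2 * t ^+ 2 * B X X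
  + (2 * K * (c * r) ^+ 2 + 2 * K * ((c + 1) * r) ^+ 3) * t ^+ 3.
Proof.
move=> c0 rt.
have tt : 0 <= t ^+ 2 by exact: sqr_ge0.
have t21 : t ^+ 2 <= t by rewrite expr2 ler_piMr// ltW.
have t43 : t ^+ 4 <= t ^+ 3 by rewrite [leLHS]exprS ler_piMl// exprn_ge0// ltW.
have tr : t * `|X| <= t * r by rewrite ler_wpM2l// ltW.
have ct : c * t ^+ 2 <= c * t by rewrite ler_wpM2l.
have cX : `|(c * t ^+ 2) *: X| <= c * r * t ^+ 2.
  rewrite normrZ ger0_norm; last exact: mulr_ge0.
  by rewrite [leRHS]mulrAC ler_wpM2l// mulr_ge0.
have cX' : `|(c * t ^+ 2) *: X| <= c * r * t.
  by apply: le_trans cX _; rewrite ler_wpM2l// mulr_ge0.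
have tX s : `|s| = t -> `|s *: X| <= r * t by move=> st; rewrite normrZ st mulrC; lra.
have crt0 : 0 <= r * t by rewrite mulr_ge0// ltW.
apply: (le_trans (@jet_pair f Y l B K X X (c * t ^+ 2) t ((c + 1) * r * t) K0 BC fT _ _ rt)).
- apply: le_trans (ler_normD _ _) _; have := tX t (gtr0_norm t0); lra.
- apply: le_trans (ler_normD _ _) _; have := tX (- t).
  by rewrite normrN gtr0_norm// => /(_ erefl); lra.
have B1 : B ((c * t ^+ 2) *: X) ((c * t ^+ 2) *: X) <= K * ((c * r) ^+ 2 * t ^+ 3).
  apply: le_trans (ler_norm _) _; apply: le_trans (B_le _) _; first lra.
  rewrite ler_wpM2l//; apply: (@le_trans _ _ ((c * r * t ^+ 2) ^+ 2)).
    by rewrite lerXn2r ?nnegrE// mulr_ge0// mulr_ge0.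
  by rewrite exprMn -exprM ler_wpM2l ?sqr_ge0.
lra.
Qed.

End SecondDifferences.

Section SphericalInequality.
Context {R : realType} {n m : nat}.
Local Notation M := 'M[R]_(n, m).
Local Notation N := (#|{: 'I_n * 'I_m}|%:R : R).

Definition rotation_differences (f : M -> R) (Y X : M) (t : R) : R :=
  \sum_(k : 'I_n * 'I_m) \sum_(j | j != k)
    (f (Y + rotation k j (- (t ^+ 2 / 2)) (Num.sqrt (t ^+ 2 - t ^+ 4 / 4)) X) +
     f (Y + rotation k j (- (t ^+ 2 / 2)) (- Num.sqrt (t ^+ 2 - t ^+ 4 / 4)) X)
     - 2 * f (Y + X)).

(** Shifting both points outward by (N - 1) / 2 * t^2 builds the first-order term (N-1)/r phi' of
    the radial Laplacian into a plain second difference, so phi never has to be differentiated. *)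
Definition radial_difference (f : M -> R) (Y X : M) (t : R) : R :=
  f (Y + (1 + t + (N - 1) / 2 * t ^+ 2) *: X) +
  f (Y + (1 - t + (N - 1) / 2 * t ^+ 2) *: X) - 2 * f (Y + X).

(** Per t^2, the rotations give -2(N-1) l(X) - 4 B(X, X) + 4 |X|^2 tr B, with |X| the Frobenius
    norm, and twice the radial difference gives 2(N-1) l(X) + 4 B(X, X). Only the trace term
    survives, and it is nonpositive. *)
Lemma differences_le (f : M -> R) (Y : M) (r : R) : superharmonic_jets f ->
    1 <= N -> 0 <= r ->
  exists K t0 : R, 0 < t0 <= 1 /\ forall X t, `|X| <= r -> 0 < t <= t0 ->
    rotation_differences f Y X t + 2 * radial_difference f Y X t <= K * t ^+ 3.
Proof.
move=> J N1 r0; have [K K0 KP] := J (`|Y| + r).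
pose c := (N - 1) / 2.
have c0 : 0 <= c by rewrite divr_ge0// subr_ge0.
pose K1 := 4 * K * r ^+ 2 + 2 * K * (3 * r) ^+ 3.
pose K2 := 2 * K * (c * r) ^+ 2 + 2 * K * ((c + 1) * r) ^+ 3.
(* This t0 gives t <= 1 and (c + 3) r t <= 1, so all increments have norm at most 1. *)
exists (\sum_(k : 'I_n * 'I_m) \sum_(j | j != k) K1 + 2 * K2), ((c + 3) * r + 1)^-1.
have D0 : 0 <= (c + 3) * r by rewrite mulr_ge0// addr_ge0.
split.
  by rewrite invr_gt0 ltr_wpDl//= invf_le1 ?lerDr// ltr_wpDl.
move=> X t Xr /andP[t0 tle].
have t1 : t <= 1.
  by apply: le_trans tle _; rewrite invf_le1 ?lerDr// ltr_wpDl.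
have rt : ((c + 3) * r) * t <= 1.
  have : ((c + 3) * r + 1) * t <= 1.
    by rewrite mulrC -ler_pdivlMr ?div1r// ltr_wpDl.
  by rewrite mulrDl; lra.
have rt0 : 0 <= r * t by rewrite mulr_ge0// ltW.
have crt0 : 0 <= c * (r * t) by rewrite mulr_ge0.
have YX : `|Y + X| <= `|Y| + r by rewrite (le_trans (ler_normD _ _))// lerD2l.
have [l [B [BC Btr l_le B_le fT]]] := KP _ YX.
pose s := Num.sqrt (t ^+ 2 - t ^+ 4 / 4).
have s0 : 0 <= s by exact: sqrtr_ge0.
have s2 : s ^+ 2 = t ^+ 2 - t ^+ 4 / 4.
  rewrite sqr_sqrtr// subr_ge0.
  have : t ^+ 4 <= t ^+ 2 * 1.
    by rewrite -[4%N]/(2 + 2)%N exprD ler_wpM2l ?sqr_ge0// exprn_ile1// ltW.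
  by have := sqr_ge0 t; lra.
have rot_le : rotation_differences f Y X t <=
    - (2 * (N - 1) * t ^+ 2 * l X) - 4 * t ^+ 2 * B X X +
    (\sum_(k : 'I_n * 'I_m) \sum_(j | j != k) K1) * t ^+ 3.
  apply: (@le_trans _ _ (\sum_(k : 'I_n * 'I_m) \sum_(j | j != k)
    (- t ^+ 2 * l (plane_part k j X) + 2 * t ^+ 2 * B (plane_turn k j X) (plane_turn k j X)
     + K1 * t ^+ 3))).
    apply: ler_sum => k _; apply: ler_sum => j _.
    have E s' : Y + rotation k j (- (t ^+ 2 / 2)) s' X = Y + X +
        (- (t ^+ 2 / 2) *: plane_part k j X + s' *: plane_turn k j X).
      by rewrite /rotation -!addrA.
    rewrite !E -/s.
    apply: (jet_rotation_pair K0 BC B_le fT Xr t0 t1 k j s0 s2); lra.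
  have sumE (u v w : 'I_n * 'I_m -> 'I_n * 'I_m -> R) :
    \sum_k \sum_(j | j != k) (u k j + v k j + w k j) =
    \sum_k \sum_(j | j != k) u k j + \sum_k \sum_(j | j != k) v k j
     + \sum_k \sum_(j | j != k) w k j.
    rewrite -!big_split; apply: eq_bigr => k _ /=; by rewrite -!big_split.
  have sumZ (b : R) (u : 'I_n * 'I_m -> 'I_n * 'I_m -> R) :
    \sum_k \sum_(j | j != k) b * u k j = b * \sum_k \sum_(j | j != k) u k j.
    by rewrite mulr_sumr; apply: eq_bigr => k _; rewrite mulr_sumr.
  rewrite sumE (sumZ (- t ^+ 2)) (sumZ (2 * t ^+ 2)) (sum_plane_turn X BC).
  have -> : \sum_(k : 'I_n * 'I_m) \sum_(j | j != k) l (plane_part k j X) =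
      2 * (N - 1) * l X.
    rewrite [in RHS](sum_mx_coord X) linear_sum -sum_neq_sym.
    by apply: eq_bigr => k _; apply: eq_bigr => j _; rewrite linearD.
  have -> : \sum_(k : 'I_n * 'I_m) \sum_(j | j != k) K1 * t ^+ 3 =
      (\sum_(k : 'I_n * 'I_m) \sum_(j | j != k) K1) * t ^+ 3.
    by rewrite mulr_suml; apply: eq_bigr => k _; rewrite mulr_suml.
  have tr_le0 : \sum_(k : 'I_n * 'I_m) B (unit_mx k) (unit_mx k) <= 0.
    by move: Btr; rewrite pair_big.
  have : t ^+ 2 * sqnorm X * (\sum_(k : 'I_n * 'I_m) B (unit_mx k) (unit_mx k)) <= 0.
    rewrite mulr_ge0_le0// mulr_ge0 ?sqr_ge0//; apply: sumr_ge0 => k _.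
    exact: sqr_ge0.
  lra.
have rad_le : radial_difference f Y X t <=
    (N - 1) * t ^+ 2 * l X + 2 * t ^+ 2 * B X X + K2 * t ^+ 3.
  have := @jet_radial_pair _ _ _ f (Y + X) X l B K r t K0 BC B_le fT Xr t0 t1 c c0.
  have -> : 2 * c = N - 1 by rewrite /c; field.
  rewrite /radial_difference -/c.
  have E s' : Y + X + ((c * t ^+ 2) *: X + s' *: X) = Y + (1 + s' + c * t ^+ 2) *: X.
    by rewrite -addrA !scalerDl scale1r; congr (_ + _); rewrite -addrA; congr (_ + _);
      rewrite addrC.
  rewrite !E; apply; lra.
by move: rot_le rad_le; lra.
Qed.

End SphericalInequality.

(** * A minimum principle for radial functions *)

Section RadialMinimumPrinciple.
Context {R : realType}.

(** If phi r1 > phi 0, then v = phi + eta / x - kap x^2 has an interior minimum on some [rho, r1].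
    There its shifted second difference is nonnegative, yet 1/x contributes at most 0 because c >=
    1, and -kap x^2 contributes at most -2 kap z^2 t^2, which beats K t^3 for small t. *)
Lemma radial_decrease (phi : R -> R) (c : R) : 1 <= c -> continuous phi ->
    (forall r, 0 <= phi r) ->
    (forall r, 0 < r -> exists K t0 : R, 0 < t0 /\ forall t, 0 < t <= t0 ->
       phi (r * (1 + t + c * t ^+ 2)) + phi (r * (1 - t + c * t ^+ 2)) - 2 * phi r
       <= K * t ^+ 3) ->
  forall r, 0 < r -> phi r <= phi 0.
Proof.
move=> c1 cphi phi0 dphi r1 r10; rewrite leNgt; apply/negP => lt_phi.
pose d := phi r1 - phi 0; have d0 : 0 < d by rewrite subr_gt0.
pose kap := d / (3 * r1 ^+ 2).
have r12 : 0 < r1 ^+ 2 by rewrite exprn_gt0.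
have kap0 : 0 < kap by rewrite divr_gt0// mulr_gt0.
have kapE : kap * r1 ^+ 2 = d / 3 by rewrite /kap; field; rewrite gt_eqF.
have [x0 /andP[x00 x0r] phix0] : exists2 x0, 0 < x0 < r1 & phi x0 < phi 0 + d / 3.
  have /cvgrPdist_lt /(_ (d / 3)) := cphi 0.
  rewrite divr_gt0// => /(_ isT) /nbhs_ballP[b /= b0 bphi].
  pose x0 := Num.min (b / 2) (r1 / 2).
  have x00 : 0 < x0 by rewrite lt_min !divr_gt0.
  have x0b : x0 <= b / 2 by rewrite ge_min lexx.
  have x0r : x0 <= r1 / 2 by rewrite ge_min lexx orbT.
  exists x0; first by rewrite x00/=; lra.
  have := bphi x0; rewrite /ball /= sub0r normrN gtr0_norm// => h.
  have : x0 < b by lra.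
  by move=> /h; rewrite ltr_norml => /andP[]; lra.
pose eta := x0 * d / 6; have eta0 : 0 < eta by rewrite divr_gt0// mulr_gt0.
(* The choices kap r1^2 = d/3 and eta / x0 = d/6 place v at x0 strictly below phi 0 + 2d/3, and v at
   r1 at or above this level. *)
pose v x := phi x + eta / x - kap * x ^+ 2.
have v0 : v x0 < phi 0 + d * 2 / 3.
  have : eta / x0 = d / 6 by rewrite /eta; field; rewrite gt_eqF.
  have : 0 <= kap * x0 ^+ 2 by rewrite mulr_ge0 ?sqr_ge0// ltW.
  by rewrite /v; lra.
have vr1 : phi 0 + d * 2 / 3 <= v r1.
  rewrite /v kapE; have : 0 <= eta / r1 by rewrite divr_ge0// ltW.
  by rewrite /d; lra.
have p0 := phi0 0.
have pd : 0 < phi 0 + d by lra.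
(* The second entry gives eta / rho >= phi 0 + d; as phi >= 0, this keeps v at rho at or above the
   same level. *)
pose rho := Num.min (x0 / 2) (eta / (phi 0 + d)).
have rho0 : 0 < rho by rewrite lt_min; apply/andP; split; apply: divr_gt0.
have rhox : rho < x0.
  by apply: (@le_lt_trans _ _ (x0 / 2)); [rewrite ge_min lexx|lra].
have vrho : phi 0 + d * 2 / 3 <= v rho.
  have : phi 0 + d <= eta / rho.
    rewrite ler_pdivlMr// mulrC -ler_pdivlMr//.
    by rewrite ge_min lexx orbT.
  have : kap * rho ^+ 2 <= kap * r1 ^+ 2.
    rewrite ler_wpM2l ?(ltW kap0)// lerXn2r ?nnegrE ?ltW//.
    exact: lt_trans x0r.
  by rewrite kapE /v; have := phi0 rho; lra.
have rhor1 : rho <= r1 by rewrite ltW// (lt_trans rhox).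
have [|z zI zmin] := @EVT_min _ v rho r1 rhor1.
  apply: continuous_in_subspaceT => x; rewrite inE /= in_itv /= => /andP[rx _].
  have x_gt0 : 0 < x by exact: lt_le_trans rx.
  apply: cvgB; last first.
    by apply: cvgM; [exact: cvg_cst|exact: exprn_continuous].
  apply: cvgD; first exact: cphi.
  apply: cvgM; first exact: cvg_cst.
  by apply: cvgV; [rewrite gt_eqF|exact: cvg_id].
have vz : v z <= v x0 by apply: zmin; rewrite in_itv /= !ltW.
have zrho : rho < z.
  move: zI; rewrite in_itv /= le_eqVlt => /andP[/orP[/eqP zE|//] _].
  by move: vz vrho; rewrite zE; lra.
have zr1 : z < r1.
  move: zI; rewrite in_itv /= [X in _ && X]le_eqVlt => /andP[_ /orP[/eqP zE|//]].
  by move: vz vr1; rewrite zE; lra.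
have z0 : 0 < z by exact: lt_trans zrho.
have [K [t0 [t00 hK]]] := dphi z z0.
have z2 : 0 < kap * z ^+ 2 by rewrite mulr_gt0// exprn_gt0.
have zc : 0 < z * (1 + c) by rewrite mulr_gt0//; lra.
(* The bounds serve in turn: validity of the difference inequality, positivity of [b], z a <= r1, z
   b >= rho, and domination of the cubic error. *)
pose t := Num.min t0 (Num.min 2^-1 (Num.min ((r1 - z) / (z * (1 + c)))
  (Num.min ((z - rho) / z) (kap * z ^+ 2 / (`|K| + 1))))).
have K1 : 0 < `|K| + 1 by rewrite ltr_wpDl.
have tpos : 0 < t.
  by rewrite !lt_min t00 invr_gt0 ltr0n /= !divr_gt0// subr_gt0.
have tt0 : t <= t0 by rewrite ge_min lexx.
have t12 : t <= 2^-1 by rewrite !ge_min lexx orbT.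
have tr1 : z * (1 + c) * t <= r1 - z.
  by rewrite mulrC -ler_pdivlMr// !ge_min lexx !orbT.
have trho : z * t <= z - rho by rewrite mulrC -ler_pdivlMr// !ge_min lexx !orbT.
have tK : (`|K| + 1) * t <= kap * z ^+ 2.
  by rewrite mulrC -ler_pdivlMr// !ge_min lexx !orbT.
have t2 : 0 < t ^+ 2 by rewrite exprn_gt0.
have t2t : t ^+ 2 <= t by rewrite expr2 ler_piMr ?(ltW tpos)//; lra.
have c0 : 0 < c by exact: lt_le_trans c1.
have ct2 : 0 < c * t ^+ 2 by rewrite mulr_gt0.
have ct2' : c * t ^+ 2 <= c * t by rewrite ler_wpM2l// ltW.
pose a := 1 + t + c * t ^+ 2; pose b := 1 - t + c * t ^+ 2.
have a0 : 0 < a by rewrite /a; clear - tpos ct2; lra.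
have b0 : 0 < b by rewrite /b; clear - t12 ct2; lra.
have ztc : z * (c * t ^+ 2) <= z * (c * t) by rewrite ler_wpM2l// ltW.
have zt0 : 0 < z * t by rewrite mulr_gt0.
have zct0 : 0 < z * (c * t ^+ 2) by rewrite mulr_gt0.
have va : v z <= v (z * a).
  apply: zmin; rewrite in_itv /= /a; clear - tr1 zrho zt0 zct0 ztc.
  by apply/andP; split; lra.
have vb : v z <= v (z * b).
  apply: zmin; rewrite in_itv /= /b; clear - tr1 trho zt0 zct0 ztc.
  by apply/andP; split; lra.
have htz := hK t; rewrite tpos tt0 -/a -/b in htz; have {}htz := htz isT.
have inv_le : eta / (z * a) + eta / (z * b) <= 2 * (eta / z).
  have -> : eta / (z * a) + eta / (z * b) = eta / z * ((a + b) / (a * b)).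
    by field; rewrite !gt_eqF.
  rewrite mulrC ler_wpM2r//; first by rewrite divr_ge0// ltW.
  rewrite ler_pdivrMr ?mulr_gt0// -subr_ge0.
  (* The only place where c >= 1 itself is decisive: it is the condition that 1/x satisfy the
     difference inequality. *)
  have -> : 2 * (a * b) - (a + b) = 2 * ((c - 1) * t ^+ 2 + (c * t ^+ 2) ^+ 2).
    by rewrite /a /b; ring.
  by rewrite mulr_ge0// addr_ge0 ?sqr_ge0// mulr_ge0 ?subr_ge0// ltW.
have sq_ge : 2 * (kap * z ^+ 2) + 2 * (kap * z ^+ 2) * t ^+ 2 <=
    kap * (z * a) ^+ 2 + kap * (z * b) ^+ 2.
  have -> : kap * (z * a) ^+ 2 + kap * (z * b) ^+ 2 = 2 * (kap * z ^+ 2) +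
      2 * (kap * z ^+ 2) * t ^+ 2 + (kap * z ^+ 2) * (4 * (c * t ^+ 2)
      + 2 * (c * t ^+ 2) ^+ 2) by rewrite /a /b; ring.
  rewrite lerDl; apply: mulr_ge0; first exact: ltW.
  by apply: addr_ge0; apply: mulr_ge0; rewrite ?sqr_ge0 ?(ltW ct2).
have : 2 * (kap * z ^+ 2) * t ^+ 2 <= K * t ^+ 3.
  by move: va vb htz inv_le sq_ge; clear; rewrite /v; lra.
have : K * t ^+ 3 <= kap * z ^+ 2 * t ^+ 2.
  rewrite exprS mulrA ler_wpM2r ?(ltW t2)//.
  apply: le_trans tK; rewrite ler_wpM2r ?(ltW tpos)//.
  by apply: le_trans (ler_norm _) _; rewrite lerDl.
have : 0 < kap * z ^+ 2 * t ^+ 2 by rewrite mulr_gt0.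
by clear; lra.
Qed.

End RadialMinimumPrinciple.

(** * Means over the unit sphere *)

Section SphereMean.
Context {R : realType} {n m : nat}.
Local Notation M := 'M[R]_(n, m).
Local Notation BM := (borel_matrix R n m).
Implicit Types (u v : M -> R).

Lemma continuous_measurable_borel u : continuous u ->
  measurable_fun [set: BM] (u : BM -> R).
Proof.
move=> /continuousP cu; apply: (measurability _ (RGenOpens.measurableE R)).
move=> _ [_ [a [b ->] <-]]; rewrite setTI; apply: sub_gen_smallest.
exact/cu/interval_open.
Qed.

Lemma continuous_measurable_borel_mx (L : M -> M) : continuous L ->
  measurable_fun [set: BM] (L : BM -> BM).
Proof.
move=> /continuousP cL; apply: (@measurability _ _ BM BM setT (L : BM -> BM) (@open M) erefl).
move=> _ [A oA <-]; rewrite setTI; apply: sub_gen_smallest.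
exact: cL.
Qed.

Definition unit_sphere : set BM := [set V : M | frobenius V = 1].

Lemma frobeniusE (V : M) : frobenius V = Num.sqrt (sqnorm V).
Proof. by rewrite /frobenius sqnormE. Qed.

Lemma sqnorm_ge0 (V : M) : 0 <= sqnorm V.
Proof. by apply: sumr_ge0 => k _; exact: sqr_ge0. Qed.

Lemma unit_sphereE (V : M) : unit_sphere V <-> sqnorm V = 1.
Proof.
rewrite /unit_sphere /= frobeniusE; split => [h|->]; last exact: sqrtr1.
by rewrite -(sqr_sqrtr (sqnorm_ge0 V)) h expr1n.
Qed.

Lemma unit_sphere_norm (V : M) : unit_sphere V -> `|V| <= 1.
Proof.
move=> /unit_sphereE V1; rewrite [leLHS]/Num.norm /= mx_normrE.
apply: bigmax_le => // -[i j] _ /=.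
rewrite -(@expr_le1 _ 2)// real_normK ?num_real// -V1 /sqnorm (bigD1 (i, j))//=.
by rewrite lerDl sumr_ge0// => k _; exact: sqr_ge0.
Qed.

Lemma continuous_sqnorm : continuous (@sqnorm R n m).
Proof.
apply: (@continuous_big _ _ +%R); first exact: add_continuous.
move=> k _ V; apply: (@continuous_comp _ _ _ (fun V : M => mx_coord V k) (fun x => x ^+ 2)).
  exact: coord_continuous.
exact: exprn_continuous.
Qed.

Variable mu : probability BM R.
Hypothesis mu_sphere : is_unit_sphere_measure mu.

Lemma measurable_unit_sphere : measurable unit_sphere.
Proof.
rewrite (_ : unit_sphere = setT `&` (@sqnorm R n m : BM -> R) @^-1` [set 1]).
  apply: (continuous_measurable_borel continuous_sqnorm) => //.
by rewrite setTI; apply/seteqP; split => V /= /unit_sphereE.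
Qed.

Lemma mu_unit_sphere : mu unit_sphere = 1%E.
Proof. by case: mu_sphere. Qed.

Definition bounded_continuous u := continuous u /\ exists C, forall V, `|u V| <= C.

Lemma bounded_continuous_integrable u : bounded_continuous u ->
  mu.-integrable unit_sphere (EFin \o (u : BM -> R)).
Proof.
move=> [cu [C uC]]; apply: measurable_bounded_integrable.
- exact: measurable_unit_sphere.
- by rewrite [X in (X < _)%E]mu_unit_sphere ltry.
- apply: measurable_funTS; exact: continuous_measurable_borel.
- exists C; split; first exact: num_real.
  by move=> D CD V _ /=; apply: le_trans (uC V) (ltW CD).
Qed.

(** Restricting to the sphere, which carries [mu], makes comparisons on the sphere sufficient in
    [le_mean]. *)
Definition mean u : R := \int[mu]_(V in unit_sphere) u V.

Lemma meanD u v : bounded_continuous u -> bounded_continuous v ->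
  mean (fun V => u V + v V) = mean u + mean v.
Proof.
move=> ub vb; apply: RintegralD; first exact: measurable_unit_sphere.
  exact: bounded_continuous_integrable.
exact: bounded_continuous_integrable.
Qed.

Lemma meanZ (a : R) u : bounded_continuous u -> mean (fun V => a * u V) = a * mean u.
Proof.
move=> ub; apply: RintegralZl; first exact: measurable_unit_sphere.
exact: bounded_continuous_integrable.
Qed.

Lemma mean_cst (a : R) : mean (fun _ => a) = a.
Proof.
have -> : mean (fun _ => a) = a * fine (mu unit_sphere).
  by apply: Rintegral_cst; exact: measurable_unit_sphere.
by rewrite [X in fine X]mu_unit_sphere mulr1.
Qed.

Lemma le_mean u v : bounded_continuous u -> bounded_continuous v ->
  (forall V, unit_sphere V -> u V <= v V) -> mean u <= mean v.
Proof.
move=> ub vb uv; apply: le_Rintegral.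
- exact: measurable_unit_sphere.
- exact: bounded_continuous_integrable.
- exact: bounded_continuous_integrable.
- exact: uv.
Qed.

Lemma mean_isometry u (L : {linear M -> M}) : bounded_continuous u -> continuous L ->
  (forall V, sqnorm (L V) = sqnorm V) -> mean (fun V => u (L V)) = mean u.
Proof.
move=> ub cL Liso; rewrite /mean /Rintegral; congr fine.
have mL := continuous_measurable_borel_mx cL.
have LS : (L : BM -> BM) @^-1` unit_sphere = unit_sphere.
  by apply/seteqP; split => V /= /unit_sphereE; rewrite ?Liso => h;
    apply/unit_sphereE; rewrite ?Liso.
have iuL : mu.-integrable unit_sphere (EFin \o ((u \o L) : BM -> R)).
  apply: bounded_continuous_integrable; split.
    by move=> V; apply: continuous_comp; [exact: cL|exact: ub.1].
  by have [_ [C uC]] := ub; exists C => V; exact: uC.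
transitivity (\int[pushforward mu (L : BM -> BM)]_(V in unit_sphere) (EFin \o (u : BM -> R)) V)%E.
  rewrite integral_pushforward ?LS//.
  - by apply/measurable_EFinP; exact: continuous_measurable_borel ub.1.
  - exact: measurable_unit_sphere.
apply: eq_measure_integral => A mA _.
have [_] := mu_sphere; apply => //.
by move=> V; rewrite !frobeniusE Liso.
Qed.

End SphereMean.

Section BoundedContinuous.
Context {R : realType} {n m : nat}.
Local Notation M := 'M[R]_(n, m).
Implicit Types (u v f : M -> R).

Lemma bounded_continuousD u v : bounded_continuous u -> bounded_continuous v ->
  bounded_continuous (fun V => u V + v V).
Proof.
move=> [cu [C uC]] [cv [D vD]]; split.
  by move=> V; exact: (cvgD (cu V) (cv V)).
by exists (C + D) => V; apply: le_trans (ler_normD _ _) _; exact: lerD.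
Qed.

Lemma bounded_continuousZ (a : R) u : bounded_continuous u ->
  bounded_continuous (fun V => a * u V).
Proof.
move=> [cu [C uC]]; split.
  by move=> V; exact: (cvgM (cvg_cst a) (cu V)).
by exists (`|a| * C) => V; rewrite normrM ler_wpM2l.
Qed.

Lemma bounded_continuous_cst (a : R) : bounded_continuous (fun _ : M => a).
Proof.
split; first exact: cst_continuous.
by exists `|a| => V; exact: lexx.
Qed.

Lemma bounded_continuous_sum (I : Type) (s : seq I) (P : pred I) (u : I -> M -> R) :
    (forall i, P i -> bounded_continuous (u i)) ->
  bounded_continuous (fun V => \sum_(i <- s | P i) u i V).
Proof.
move=> ub; elim: s => [|i s IH].
  under eq_fun do rewrite big_nil.
  exact: bounded_continuous_cst.
under eq_fun do rewrite big_cons.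
by case Pi : (P i) => //; apply: bounded_continuousD => //; exact: ub.
Qed.

Variable mu : probability (borel_matrix R n m) R.
Hypothesis mu_sphere : is_unit_sphere_measure mu.

Lemma mean_sum (I : Type) (s : seq I) (P : pred I) (u : I -> M -> R) :
    (forall i, P i -> bounded_continuous (u i)) ->
  mean mu (fun V => \sum_(i <- s | P i) u i V) = \sum_(i <- s | P i) mean mu (u i).
Proof.
move=> ub; elim: s => [|i s IH].
  rewrite big_nil; under [X in mean _ X]eq_fun do rewrite big_nil.
  exact: mean_cst.
rewrite big_cons; under [X in mean _ X]eq_fun do rewrite big_cons.
case Pi : (P i) => //; rewrite meanD ?IH//; first exact: ub.
exact: bounded_continuous_sum.
Qed.

Lemma continuous_rotation (k l : 'I_n * 'I_m) (a s : R) :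
  continuous (rotation k l a s : M -> M).
Proof.
have cD (u v : M -> M) : continuous u -> continuous v -> continuous (fun X => u X + v X).
  by move=> cu cv X; exact: (cvgD (cu X) (cv X)).
have cZ (b : R) (u : M -> M) : continuous u -> continuous (fun X => b *: u X).
  by move=> cu X; exact: (@cvgZl_tmp R M M (nbhs X) _ b u _ (cu X)).
have cc j (e : M) : continuous (fun X : M => mx_coord X j *: e).
  move=> X; have h := @coord_continuous R n m j.1 j.2 X.
  exact: (@cvgZr_tmp R M M (nbhs X) _ (fun V : M => mx_coord V j) _ e h).
have cN j (e : M) : continuous (fun X : M => - (mx_coord X j *: e)).
  by move=> X; exact: (cvgN (cc j e X)).
rewrite /rotation /plane_part /plane_turn.
apply: (cD (fun X : M => X + _)); last by apply: cZ; exact: cD.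
apply: (cD id); first by move=> X; exact: cvg_id.
by apply: cZ; exact: cD.
Qed.

End BoundedContinuous.

(** * The mean value inequality for functions with superharmonic jets *)

Section MeanValue.
Context {R : realType} {n m : nat}.
Local Notation M := 'M[R]_(n, m).
Local Notation N := (#|{: 'I_n * 'I_m}|%:R : R).
Variable f : M -> R.
Hypothesis fJ : superharmonic_jets f.

Lemma jets_lipschitz (rho : R) : exists2 K, 0 <= K &
  forall X H, `|X| <= rho -> `|H| <= 1 -> `|f (X + H) - f X| <= K * `|H|.
Proof.
have [K K0 KP] := fJ rho; exists (3 * K) => [|X H Xr H1]; first by rewrite mulr_ge0.
have [l [B [_ _ lK BK fK]]] := KP X Xr.
have H2 : K * `|H| ^+ 2 <= K * `|H| by rewrite ler_wpM2l// expr2 ler_piMl.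
have H3 : K * `|H| ^+ 3 <= K * `|H|.
  by rewrite ler_wpM2l// exprS ler_piMr// exprn_ile1.
have -> : f (X + H) - f X = (f (X + H) - (f X + l H + B H H)) + l H + B H H by ring.
apply: le_trans (ler_normD _ _) _; have := BK H H1.
have := ler_normD (f (X + H) - (f X + l H + B H H)) (l H).
have := lK H H1; have := fK H H1; lra.
Qed.

Lemma jets_continuous : continuous f.
Proof.
move=> X; have [K K0 KP] := jets_lipschitz `|X|.
apply/(@cvgrPdist_le _ _ M (nbhs X) _ f (f X)) => /= e e0.
apply/nbhs_ballP; exists (Num.min 1 (e / (K + 1))) => /=.
  by rewrite lt_min ltr01 divr_gt0// ltr_wpDl.
move=> Y; rewrite -ball_normE /= lt_min => /andP[XY1 XYe].
rewrite distrC in XY1; rewrite distrC in XYe; rewrite distrC.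
have := KP X (Y - X) (lexx _) (ltW XY1); rewrite (addrC X) subrK => /le_trans; apply.
apply: (@le_trans _ _ ((K + 1) * `|Y - X|)).
  by rewrite ler_wpM2r// lerDl.
by rewrite mulrC -ler_pdivlMr ?ltW// ltr_wpDl.
Qed.

Hypothesis f0 : forall X, 0 <= f X.
Variable C : R.
Hypothesis fC : forall X, f X <= C.

Lemma jets_bounded_continuous (A : M) (r : R) (L : M -> M) : continuous L ->
  bounded_continuous (fun V => f (A + r *: L V)).
Proof.
move=> cL; split.
  move=> V; apply: (@continuous_comp _ _ _ (fun V => A + r *: L V) f).
    exact: (cvgD (cvg_cst A) (@cvgZl_tmp R M M (nbhs V) _ r L _ (cL V))).
  exact: jets_continuous.
by exists C => V; rewrite ger0_norm.
Qed.

Lemma jets_bounded_continuous_id (A : M) (r : R) :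
  bounded_continuous (fun V => f (A + r *: V)).
Proof. by apply: (@jets_bounded_continuous A r id) => V; exact: cvg_id. Qed.

Variable mu : probability (borel_matrix R n m) R.
Hypothesis mu_sphere : is_unit_sphere_measure mu.

Lemma mean_rotation (A : M) (r a s : R) (k l : 'I_n * 'I_m) : k != l ->
    (1 + a) ^+ 2 + s ^+ 2 = 1 ->
  mean mu (fun V => f (A + rotation k l a s (r *: V))) = mean mu (fun V => f (A + r *: V)).
Proof.
move=> kl as1; under [X in mean _ X]eq_fun do rewrite linearZ /=.
apply: (@mean_isometry _ _ _ mu mu_sphere (fun V => f (A + r *: V))).
- exact: jets_bounded_continuous_id.
- exact: continuous_rotation.
- by move=> V; exact: rotation_sqnorm.
Qed.

Lemma sphere_mean_le (A : M) (r : R) : 3 <= N -> 0 < r ->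
  mean mu (fun V => f (A + r *: V)) <= f A.
Proof.
move=> N3 r0; pose phi r := mean mu (fun V => f (A + r *: V)).
have fbc := jets_bounded_continuous_id.
have phi_0 : phi 0 = f A.
  rewrite /phi; under [X in mean _ X]eq_fun do rewrite scale0r addr0.
  exact: mean_cst.
rewrite -phi_0 -/(phi r); apply: (@radial_decrease _ phi ((N - 1) / 2)) => //.
- lra.
(* Continuity of phi at x: f is Lipschitz near the sphere of radius |x| with one constant for all
   directions, and the bound survives averaging. *)
- move=> x; have [K K0 KP] := jets_lipschitz (`|A| + `|x|).
  have mean_le y z (b : R) :
      (forall V, unit_sphere V -> f (A + y *: V) <= f (A + z *: V) + b) ->
      phi y <= phi z + b.
    move=> yz; rewrite /phi -[X in _ <= _ + X](mean_cst mu_sphere) -meanD//; last first.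
      exact: bounded_continuous_cst.
    by apply: le_mean => //; apply: bounded_continuousD => //; exact: bounded_continuous_cst.
  have lip y V : `|x - y| <= 1 -> unit_sphere V ->
      `|f (A + y *: V) - f (A + x *: V)| <= K * `|x - y|.
    move=> xy1 /unit_sphere_norm V1.
    have -> : A + y *: V = (A + x *: V) + (y - x) *: V.
      by rewrite -addrA -scalerDl [x + _]addrC subrK.
    have yxV : `|(y - x) *: V| <= `|x - y|.
      by rewrite normrZ (distrC y) ler_piMr.
    have AxV : `|A + x *: V| <= `|A| + `|x|.
      by rewrite (le_trans (ler_normD _ _))// lerD2l normrZ ler_piMr.
    apply: le_trans (KP _ _ AxV (le_trans yxV xy1)) _.
    by rewrite ler_wpM2l.
  apply/cvgrPdist_le => /= e e0.
  apply/nbhs_ballP; exists (Num.min 1 (e / (K + 1))) => /=.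
    by rewrite lt_min ltr01 divr_gt0// ltr_wpDl.
  move=> y; rewrite /ball /= lt_min => /andP[/ltW xy1 /ltW xye].
  have : (K + 1) * `|x - y| <= e by rewrite mulrC -ler_pdivlMr// ltr_wpDl.
  rewrite ler_norml mulrDl mul1r => xyK.
  have yx : phi y <= phi x + K * `|x - y|.
    apply: mean_le => V VS; have := lip y V xy1 VS.
    by rewrite ler_norml => /andP[_]; rewrite lerBlDl.
  have xy : phi x <= phi y + K * `|x - y|.
    apply: mean_le => V VS; have := lip y V xy1 VS.
    by rewrite ler_norml => /andP[+ _]; clear; lra.
  by have := normr_ge0 (x - y) => xy0; clear - xyK yx xy xy0; apply/andP; split; lra.
- move=> x; rewrite -(mean_cst mu_sphere 0); apply: le_mean => //.
  exact: bounded_continuous_cst.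
move=> x x0.
have [|K [t0 [/andP[t00 t01] KP]]] := differences_le A fJ _ (ltW x0); first by lra.
exists (K / 2), t0; split => // t /andP[tpos tt0].
pose c := (N - 1) / 2; rewrite -/c.
pose a := - (t ^+ 2 / 2); pose s := Num.sqrt (t ^+ 2 - t ^+ 4 / 4).
have as1 : (1 + a) ^+ 2 + s ^+ 2 = 1.
  have t2 : t ^+ 2 <= 1 by rewrite exprn_ile1 ?(ltW tpos)// (le_trans tt0).
  rewrite /s sqr_sqrtr /a; first by field.
  have -> : t ^+ 2 - t ^+ 4 / 4 = t ^+ 2 * (1 - t ^+ 2 / 4) by field.
  by rewrite mulr_ge0 ?sqr_ge0//; lra.
have as1' : (1 + a) ^+ 2 + (- s) ^+ 2 = 1 by rewrite sqrrN.
have rotbc k l b d : bounded_continuous (fun V : M => f (A + rotation k l b d (x *: V))).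
  under eq_fun do rewrite linearZ /=.
  by apply: jets_bounded_continuous; exact: continuous_rotation.
have termbc k l : bounded_continuous (fun V : M =>
    f (A + rotation k l a s (x *: V)) + f (A + rotation k l a (- s) (x *: V))
    + - 2 * f (A + x *: V)).
  apply: bounded_continuousD; last exact: bounded_continuousZ.
  exact: bounded_continuousD.
(* By invariance each rotated copy has the mean phi(x), so every summand averages to phi(x) + phi(x)
   - 2 phi(x) = 0. *)
have rot0 : mean mu (fun V => rotation_differences f A (x *: V) t) = 0.
  rewrite /rotation_differences -/a -/s.
  under [X in mean _ X]eq_fun do under eq_bigr do under eq_bigr do rewrite -mulNr.
  rewrite mean_sum//; last by move=> k _; apply: bounded_continuous_sum.
  rewrite big1// => k _; rewrite mean_sum// big1// => j jk.
  rewrite !meanD//; [|exact: bounded_continuousD|exact: bounded_continuousZ].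
  by rewrite meanZ// !mean_rotation// 1?eq_sym//; ring.
pose x1 := x * (1 + t + c * t ^+ 2); pose x2 := x * (1 - t + c * t ^+ 2).
have radE V : radial_difference f A (x *: V) t =
    f (A + x1 *: V) + f (A + x2 *: V) + - 2 * f (A + x *: V).
  by rewrite /radial_difference -/c !scalerA /x1 /x2 ![x * _]mulrC mulNr.
have radbc : bounded_continuous (fun V => radial_difference f A (x *: V) t).
  under eq_fun do rewrite radE.
  by apply: bounded_continuousD; [exact: bounded_continuousD|exact: bounded_continuousZ].
have radm : mean mu (fun V => radial_difference f A (x *: V) t) =
    phi x1 + phi x2 - 2 * phi x.
  under [X in mean _ X]eq_fun do rewrite radE.
  rewrite !meanD//; [|exact: bounded_continuousD|exact: bounded_continuousZ].
  by rewrite meanZ// mulNr.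
have rdbc : bounded_continuous (fun V => rotation_differences f A (x *: V) t).
  rewrite /rotation_differences -/a -/s.
  under eq_fun do under eq_bigr do under eq_bigr do rewrite -mulNr.
  by apply: bounded_continuous_sum => k _; apply: bounded_continuous_sum.
have : mean mu (fun V => rotation_differences f A (x *: V) t +
    2 * radial_difference f A (x *: V) t) <= mean mu (fun=> K * t ^+ 3).
  apply: le_mean => //.
  - by apply: bounded_continuousD => //; exact: bounded_continuousZ.
  - exact: bounded_continuous_cst.
  - move=> V /unit_sphere_norm V1; apply: KP; last by rewrite tpos.
    by rewrite normrZ gtr0_norm// ler_piMr// ltW.
rewrite meanD//; last exact: bounded_continuousZ.
by rewrite meanZ// rot0 radm (mean_cst mu_sphere) -/x1 -/x2; lra.
Qed.

End MeanValue.

(** * Passage to the limit *)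

Section IncreasingLimits.
Context {R : realType} {n m : nat}.
Local Notation M := 'M[R]_(n, m).
Local Notation N := (#|{: 'I_n * 'I_m}|%:R : R).

Lemma integral_sphere_mean_le (f : M -> R) (C : R)
    (mu : probability (borel_matrix R n m) R) (A : M) (r : R) :
    superharmonic_jets f -> (forall X, 0 <= f X) -> (forall X, f X <= C) ->
    is_unit_sphere_measure mu -> 3 <= N -> 0 < r ->
  (\int[mu]_V (f (A + r *: (V : M)))%:E <= (f A)%:E)%E.
Proof.
move=> fJ f0 fC mu_sphere N3 r0.
have bc := jets_bounded_continuous_id fJ f0 fC A r.
pose g (V : borel_matrix R n m) := (f (A + r *: (V : M)))%:E.
have mS := @measurable_unit_sphere R n m.
rewrite -/(\int[mu]_V g V)%E.
rewrite (@ge0_negligible_integral _ _ _ mu setT (~` unit_sphere))//; last 4 first.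
- exact: measurableC.
- by apply/measurable_EFinP; exact: continuous_measurable_borel bc.1.
- by move=> V _; rewrite lee_fin.
- by rewrite [LHS](probability_setC mu mS) [X in (1 - X)%E](mu_unit_sphere mu_sphere) subee.
rewrite setDE setTI setCK.
rewrite -[leLHS]fineK; last first.
  by apply: integrable_fin_num => //; exact: bounded_continuous_integrable.
by rewrite lee_fin; exact: sphere_mean_le fJ f0 _ fC mu mu_sphere A r N3 r0.
Qed.

(** The two comparison hypotheses say that f is the pointwise supremum of the [F k], the value +oo
    included. A supremum of continuous functions is lower semicontinuous, and monotone convergence
    of nonnegative functions transports the mean inequality. *)
Lemma superharmonic_increasing_limit (f : M -> \bar R) (F : nat -> M -> R) :
    3 <= N ->
    (forall k, superharmonic_jets (F k)) ->
    (forall k X, 0 <= F k X) ->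
    (forall k, exists C, forall X, F k X <= C) ->
    (forall X, nondecreasing_seq (F^~ X)) ->
    (forall k X, ((F k X)%:E <= f X)%E) ->
    (forall (a : R) X, (a%:E < f X)%E -> exists k, a < F k X) ->
    (exists X, f X != +oo%E) ->
  superharmonic f.
Proof.
move=> N3 FJ F0 FC Fnd Ff fF fX; split => //.
- by move=> X; rewrite gt_eqF// (lt_le_trans _ (Ff 0%N X))// ltNyr.
- move=> X a /fF[k aF].
  have cF := jets_continuous (FJ k).
  exists [set Y | a < F k Y].
    exact: (cF X _ (open_nbhs_nbhs (conj (@open_gt R a) aF))).
  by move=> Y /= aFY; rewrite (lt_le_trans _ (Ff k Y))// lte_fin.
move=> mu mu_sphere A r r0.
have limE X : limn (fun k => (F k X)%:E) = f X.
  apply/cvg_lim => //.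
  have nd : {homo (fun k => (F k X)%:E) : k l / (k <= l)%N >-> (k <= l)%E}.
    by move=> k l kl; rewrite lee_fin Fnd.
  have -> : f X = ereal_sup (range (fun k => (F k X)%:E)).
    apply/eqP; rewrite eq_le; apply/andP; split; last first.
      by apply: ge_ereal_sup => _ [k _ <-]; exact: Ff.
    have ub k : ((F k X)%:E <= ereal_sup (range (fun k => (F k X)%:E)))%E.
      by apply: ereal_sup_ubound; exists k.
    rewrite leNgt; apply/negP; have := ub 0%N.
    move: ub; case: (ereal_sup _) => [s| |] ub // _; last by rewrite ltNge leey.
    by move=> /fF[k]; rewrite ltNge -lee_fin ub.
  exact: ereal_nondecreasing_cvgn.
have mF k : measurable_fun setT (fun V : borel_matrix R n m => (F k (A + r *: (V : M)))%:E).
  have [C FkC] := FC k.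
  apply/measurable_EFinP; apply: continuous_measurable_borel.
  exact: (jets_bounded_continuous_id (FJ k) (F0 k) FkC A r).1.
have -> : (\int[mu]_V f (A + r *: (V : M))%R)%E =
    limn (fun k => \int[mu]_V (F k (A + r *: (V : M))%R)%:E)%E.
  rewrite -monotone_convergence//.
  - by apply: eq_integral => V _; rewrite limE.
  - by move=> k V _; rewrite lee_fin.
  - by move=> V _ k l kl; rewrite lee_fin Fnd.
apply: lime_le.
  apply: ereal_nondecreasing_is_cvgn => k l kl; by apply: ge0_le_integral => // V _;
    rewrite lee_fin ?F0 ?Fnd.
apply: nearW => k; have [C FkC] := FC k.
exact: le_trans (integral_sphere_mean_le A (FJ k) (F0 k) FkC mu_sphere N3 r0) (Ff k A).
Qed.

End IncreasingLimits.

(** * The Schatten prior as an increasing limit *)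

Section Prior.
Context {R : realType} {n m : nat}.
Local Notation M := 'M[R]_(n, m).

(** For z > 0 equal to x or y, the ratio z / (x + y) lies in ]0, 1], where t <= t^q; summing the two
    inequalities gives the claim. *)
Lemma powR_subadditive (q x y : R) : q <= 1 -> 0 <= x -> 0 < y ->
  (x + y) `^ q <= x `^ q + y `^ q.
Proof.
move=> q1 x0 y0; have s0 : 0 < x + y by rewrite ltr_wpDl.
have h z : 0 < z -> z <= x + y -> z / (x + y) * (x + y) `^ q <= z `^ q.
  move=> z0 zs; have zs0 : 0 < z / (x + y) by exact: divr_gt0.
  rewrite -[in leRHS](divfK (lt0r_neq0 s0) z) (powRM _ (ltW zs0) (ltW s0)).
  by rewrite ler_wpM2r ?powR_ge0// ger1_powR// zs0 ler_pdivrMr// mul1r.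
have hx : x / (x + y) * (x + y) `^ q <= x `^ q.
  move: x0; rewrite le_eqVlt => /orP[/eqP<-|x0]; last by rewrite h// lerDl ltW.
  by rewrite mul0r mul0r powR_ge0.
have hy := h y y0 _; rewrite lerDr x0 in hy.
apply: le_trans (lerD hx (hy isT)).
by rewrite -mulrDl -mulrDl divff ?mul1r// gt_eqF.
Qed.

Definition schatten_sum (q : R) (X : M) := spectral_sum (fun x => x `^ q) X.

Lemma smooth_sum_gtW (q e : R) (X : M) : 0 < q -> 0 < e ->
  schatten_sum q X <= smooth_sum q e X.
Proof.
move=> q0 e0; apply: ler_sum => i _.
by apply: ge0_ler_powR; rewrite ?nnegrE ?addr_ge0 ?sqr_ge0 ?lerDl ?(ltW q0) ?(ltW e0).
Qed.

Lemma smooth_sum_le (q e : R) (X : M) : q <= 1 -> 0 < e ->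
  smooth_sum q e X <= schatten_sum q X + m%:R * e `^ q.
Proof.
move=> q1 e0; rewrite -[X in _ + X](_ : \sum_(i < m) e `^ q = _); last first.
  by rewrite sumr_const card_ord mulr_natl.
rewrite -big_split; apply: ler_sum => i _ /=.
exact: powR_subadditive (sqr_ge0 _) _.
Qed.

Lemma smooth_sum_mono (q e e' : R) (X : M) : 0 < q -> 0 < e -> e <= e' ->
  smooth_sum q e X <= smooth_sum q e' X.
Proof.
move=> q0 e0 ee'; apply: ler_sum => i _; have e'0 := lt_le_trans e0 ee'.
apply: ge0_ler_powR; rewrite ?nnegrE ?lerD2l ?(ltW q0)//.
  by rewrite addr_ge0 ?sqr_ge0 ?(ltW e0).
by rewrite addr_ge0 ?sqr_ge0 ?(ltW e'0).
Qed.

Lemma schatten_sum0 (q : R) : q != 0 -> schatten_sum q (0 : M) = 0.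
Proof.
move=> q0; rewrite /schatten_sum (@spectral_sumE _ _ _ _ _ 1%:M 0).
- by rewrite big1// => i _; rewrite mxE powR0.
- by rewrite trmx1 mulmx1.
- by rewrite mulmx0 raddf0 mulmx0 mul0mx.
Qed.

Lemma schatten_sum_gt0 (q : R) (X : M) : X != 0 -> 0 < schatten_sum q X.
Proof.
move=> X0; have [U [d [UU XX d0]]] := spectral_decomposition X.
rewrite /schatten_sum (spectral_sumE _ UU XX).
rewrite lt_def sumr_ge0 ?andbT => [|i _]; last exact: powR_ge0.
apply: contra_neq X0; move/eqP; rewrite psumr_eq0 => [|i _]; last exact: powR_ge0.
move=> /allP d_eq0.
have {}d_eq0 i : d 0 i = 0.
  by apply/eqP; have := d_eq0 i (mem_index_enum _); rewrite powR_eq0 => /andP[].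
have {}XX : X^T *m X = 0.
  rewrite XX (_ : d = 0) ?raddf0 ?mulmx0 ?mul0mx//.
  by apply/rowP => i; rewrite mxE.
apply/matrixP => i j; rewrite mxE; apply/eqP; rewrite -sqrf_eq0; apply/eqP.
have := congr1 (fun Y : 'M[R]_(m, m) => Y j j) XX; rewrite !mxE => /eqP.
rewrite psumr_eq0 => [/allP /(_ i (mem_index_enum _))|k _]; rewrite mxE -expr2.
  by move/eqP.
exact: sqr_ge0.
Qed.

Lemma powRN_antimono (c x y : R) : 0 <= c -> 0 < x -> x <= y -> y `^ (- c) <= x `^ (- c).
Proof. by move=> c0 x0 xy; apply: powR_le0_anti; rewrite ?oppr_le0. Qed.

Lemma schatten_priorE (p a : R) (X : M) : a != 0 -> X != 0 ->
  schatten_prior p a X = (schatten_sum (p / 2) X `^ (- (a / p)))%:E.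
Proof.
move=> a0 X0; rewrite /schatten_prior (negbTE a0) (negbTE X0) /schatten -powRrM.
rewrite mulrN mulrC; congr (_ `^ _)%:E; apply: eq_bigr => i _.
rewrite -powR_mulrn; last first.
  by have [_ /allP s0 _] := singular_valuesP X; apply: s0; exact: mem_tnth.
by rewrite -powRrM; congr (_ `^ _); field.
Qed.

Lemma superharmonic_prior (q c : R) (f : M -> \bar R) : (0 < m)%N -> (m <= n)%N ->
    3 <= n%:R * m%:R :> R -> 0 < q -> q <= 1 -> 0 < c -> admissible n m q c ->
    f 0 = +oo%E -> (forall X, X != 0 -> f X = (schatten_sum q X `^ (- c))%:E) ->
  superharmonic f.
Proof.
move=> m0 mn nm3 q0 q1 c0 adm f0 fE.
have e0 k : 0 < k.+1%:R^-1 :> R by rewrite invr_gt0.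
have S0 k (X : M) : 0 < smooth_sum q k.+1%:R^-1 X by exact: smooth_sum_gt0.
apply: (@superharmonic_increasing_limit _ _ _ f
  (fun k => smooth_prior q k.+1%:R^-1 c)).
- by rewrite card_prod !card_ord natrM.
- by move=> k; apply: smooth_prior_jets => //; exact: ltW.
- by move=> k X; exact: powR_ge0.
- move=> k; exists ((k.+1%:R^-1 `^ q) `^ (- c)) => X.
  apply: powRN_antimono; [exact: ltW|by rewrite powR_gt0|exact: smooth_sum_ge].
- move=> X k l kl; apply: powRN_antimono => //; first exact: ltW.
  by apply: smooth_sum_mono => //; rewrite lef_pV2 ?posrE// ler_nat ltnS.
- move=> k X; have [->|X0] := eqVneq X 0; first by rewrite f0 leey.
  rewrite (fE _ X0) lee_fin /smooth_prior; apply: powRN_antimono.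
  - exact: ltW.
  - exact: schatten_sum_gt0.
  - exact: smooth_sum_gtW.
- move=> a X aX; have [a0|a0] := leP a 0.
    by exists 0%N; apply: le_lt_trans a0 _; rewrite powR_gt0.
  (* The level of the spectral sum at which its power -c equals a. Reaching a value above a means
     bringing the regularized sum below [T], also at X = 0, where the unregularized sum is 0. *)
  pose T := a `^ (- c^-1).
  have T0 : 0 < T by rewrite powR_gt0.
  have TE : T `^ (- c) = a.
    by rewrite -powRrM mulrNN mulVf ?gt_eqF// powRr1 ?ltW.
  have ST : schatten_sum q X < T.
    have [X0|X0] := eqVneq X 0; first by rewrite X0 schatten_sum0// gt_eqF.
    rewrite ltNge; apply/negP => TS; move: aX; rewrite fE// lte_fin ltNge -TE.
    by rewrite powRN_antimono// ltW.
  (* Chosen so that m d^q = T - [schatten_sum q X], which is the room left by [smooth_sum_le]. *)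
  pose d := ((T - schatten_sum q X) / m%:R) `^ q^-1.
  have mR : 0 < m%:R :> R by rewrite ltr0n.
  have D0 : 0 < (T - schatten_sum q X) / m%:R by rewrite divr_gt0 ?subr_gt0.
  have [|k] := @ltr_add_invr _ 0 d; first by rewrite powR_gt0.
  rewrite add0r => kd; exists k; rewrite -TE.
  have STk : smooth_sum q k.+1%:R^-1 X < T.
    apply: le_lt_trans (smooth_sum_le X q1 (e0 k)) _.
    rewrite -ltrBrDl mulrC -ltr_pdivlMr//.
    have -> : (T - schatten_sum q X) / m%:R = d `^ q.
      by rewrite /d -powRrM mulVf ?gt_eqF// powRr1 ?ltW.
    by apply: gt0_ltr_powR; rewrite ?nnegrE ?powR_ge0// ltW.
  by rewrite /smooth_prior !powRN ltf_pV2 ?posrE ?powR_gt0//;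
    apply: gt0_ltr_powR; rewrite ?nnegrE ?ltW.
- exists (const_mx 1); rewrite fE//; apply/eqP => /matrixP.
  have n0 := leq_trans m0 mn.
  by move=> /(_ (Ordinal n0) (Ordinal m0)); rewrite !mxE => /eqP; rewrite oner_eq0.
Qed.

Lemma superharmonic_cst1 : superharmonic (fun _ : M => 1%E : \bar R).
Proof.
split => //.
- by move=> X a a1; exists setT => //; exact: filterT.
- by exists 0.
- by move=> mu _ X r _; rewrite integral_cst// mul1e probability_le1.
Qed.

End Prior.

Theorem theorem3 (R : realType) (n m : nat) (m_ge1 : (1 <= m)%N)
    (n_ge_m : (m <= n)%N) :
  (forall p a : R, 1 <= p <= 2 ->
     0 <= a <= n%:R * m%:R - (1 - p / 2) * m%:R * (m%:R + 1) - p ->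
     superharmonic (@schatten_prior R n m p a)) /\
  (forall p a : R, 0 < p < 1 ->
     0 <= a <= n%:R * m%:R - m%:R * (m%:R + 1) + (m%:R - 1) * p ->
     superharmonic (@schatten_prior R n m p a)).
Proof.
(* The substitution is q = p/2 and c = a/p, so that 2q (c + 1) = a + p. The last premise isolates
   the low dimensions, where the comparison with 1/r fails and only the constant prior remains. *)
have main (p a : R) : 0 < p <= 2 -> 0 <= a -> admissible n m (p / 2) (a / p) ->
    3 <= n%:R * m%:R :> R \/ a = 0 -> superharmonic (@schatten_prior R n m p a).
  move=> /andP[p0 p2] a0 adm nm3; have [->|an0] := eqVneq a 0.
    rewrite (_ : schatten_prior p 0 = fun=> 1%E); first exact: superharmonic_cst1.
    by apply/funext => X; rewrite /schatten_prior eqxx.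
  case: nm3 => [nm3|a_eq0]; last by rewrite a_eq0 eqxx in an0.
  apply: (@superharmonic_prior _ _ _ (p / 2) (a / p)) => //.
  - by rewrite divr_gt0.
  - lra.
  - by rewrite divr_gt0// lt_def an0.
  - by rewrite /schatten_prior (negbTE an0) eqxx.
  - by move=> X X0; exact: schatten_priorE.
have natr_ge (k l : nat) : (k <= l)%N -> k%:R <= l%:R :> R by rewrite ler_nat.
have mR := natr_ge _ _ m_ge1; have nR := natr_ge _ _ n_ge_m.
have nmR : (2 <= m)%N -> 3 <= n%:R * m%:R :> R.
  move=> m2; have := natr_ge _ _ m2; nra.
(* For m = 1 both bounds on a read a <= n - 2, so n <= 2 leaves only a = 0. *)
have n3 (a : R) : m = 1%N -> 0 <= a -> a <= n%:R - 2 -> 3 <= n%:R * m%:R :> R \/ a = 0.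
  move=> -> a0 an; rewrite mulr1; case: (leqP 3 n) => [/natr_ge|]; first by left.
  rewrite ltnS => /natr_ge n2; right; lra.
split=> p a pI /andP[a0 aU].
- have /andP[p1 p2] := pI; have pn0 : p != 0 by rewrite gt_eqF//; lra.
  apply: main => //; first lra.
    right; split; first lra.
    have -> : 2 * (p / 2) * (a / p + 1) = a + p by field.
    by lra.
  case: (leqP 2 m) => [/nmR|]; first by left.
  rewrite ltnS => m1; have m1E : m = 1%N by apply/eqP; rewrite eqn_leq m1.
  apply: n3 => //; move: aU; rewrite m1E; lra.
- have /andP[p0 p1] := pI; have pn0 : p != 0 by rewrite gt_eqF.
  apply: main => //; first lra.
    left; have -> : 2 * (p / 2) * (a / p + 1) = a + p by field.
    by lra.
  case: (leqP 2 m) => [/nmR|]; first by left.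
  rewrite ltnS => m1; have m1E : m = 1%N by apply/eqP; rewrite eqn_leq m1.
  apply: n3 => //; move: aU; rewrite m1E; lra.
Qed.
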